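(* Let $\Gamma$ be an infinite spherically symmetric tree with growth function $f : \{1,2,3,\ldots\} \to \{1,2,3,\ldots\}$ (arbitrary), labeled by independent exponential random variables $X(v)$ of mean $1$. Let $\tilde f$ be the function obtained from $f$ by the recursion given in the context. Then the probability of an explosion is zero or one according to whether $\sum_{n=1}^\infty \tilde f(n)^{-1}$ is infinite or finite. Furthermore, if the sum is infinite and $\tilde f$ is unbounded, then almost surely $$\limsup_{N \to \infty} \frac{M_N}{\sum_{n=1}^N \tilde f(n)^{-1}} = e^{-1}.$$
   Context: $\Gamma$ is a tree with root $\rho$; $|v|$ is the distance from $\rho$ to $v$, and $w \leq v$ means $w$ lies on the path from $\rho$ to $v$. $\Gamma$ is spherically symmetric with growth function $f$ if every vertex $v$ has exactly $f(|v|+1)$ children (neighbors farther from the root); that is, each vertex at distance $n-1$ from the root has $f(n)$ children. First-passage percolation: $X(v)$ is the transit time across the edge connecting $v$ to its parent, and $$S(v) = \sum_{\rho < w \leq v} X(w), \qquad M_n = \min_{|v| = n} S(v),$$ where the sum is over all vertices $w \neq \rho$ on the path from $\rho$ to $v$ (including $v$). An explosion is the event that the increasing sequence $(M_n)$ is bounded. The function $\tilde f : \{1,2,\ldots\} \to (0,\infty)$ is defined recursively, for $n \geq 0$, by $$\tilde f(n+1) = \sup\left\{ a : \ a^m \prod_{i=1}^n \tilde f(i) \leq \prod_{i=1}^{n+m} f(i) \ \text{ for all } m \geq 1 \right\},$$ where $a$ ranges over the positive reals and the empty product is $1$; in particular $\tilde f(1) = \inf_{m \geq 1} \left(\prod_{i=1}^m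 f(i)\right)^{1/m}$. *)

(* Defs.v *)
From HB Require Import structures.
From mathcomp Require Import all_boot all_order all_algebra.
From mathcomp Require Import all_classical all_reals all_analysis.

Set Implicit Arguments.
Unset Strict Implicit.
Unset Printing Implicit Defensive.

Import Order.TTheory GRing.Theory Num.Theory.
Import numFieldNormedType.Exports.

Local Open Scope classical_set_scope.
Local Open Scope card_scope.
Local Open Scope ring_scope.

(* [p] lists the vertices after [u]; so its size is the number of edges. *)
Definition simple_path (V : eqType) (e : rel V) (u v : V) (p : seq V) : bool :=
  [&& path e u p, uniq (u :: p) & last u p == v].

(* A rooted tree, possibly infinite: a simple graph in which any two vertices
   are joined by exactly one simple path. *)
Record rooted_tree := RootedTree {
  vertex :> choiceType ;
  adj : rel vertex ;
  tree_root : vertex ;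
  adj_sym : symmetric adj ;
  adj_irr : irreflexive adj ;
  adj_tree : forall u v : vertex, exists! p, simple_path adj u v p
}.

Arguments tree_root : clear implicits.

Section Tree.
Variable G : rooted_tree.

Lemma path_from_root_subproof (v : G) : exists p, simple_path (@adj G) (tree_root G) v p.
Proof. by have [p [? _]] := adj_tree (tree_root G) v; exists p. Qed.

(* The vertices w with root < w <= v: the root is left out, [v] is included
   (unless v is the root, where the sequence is empty). *)
Definition path_from_root (v : G) : seq G := xchoose (path_from_root_subproof v).

Definition depth (v : G) : nat := size (path_from_root v).

Definition children (v : G) : set G :=
  [set w | adj v w /\ (depth v < depth w)%N].

(* Only the values of [f] at positive integers are relevant. *)
Definition spherically_symmetric (f : nat -> nat) : Prop :=
  forall v : G, children v #= `I_(f (depth v).+1).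

End Tree.

Section Passage.
Variables (R : realType) (G : rooted_tree).

(* [x v] is the transit time across the edge from [v] to its parent; [x (tree_root G)]
   is never used. *)
Definition passage_time (x : G -> R) (v : G) : R :=
  \sum_(w <- path_from_root v) x w.

(* When every growth number is positive and finite, each level of the tree is
   finite and nonempty, so that this infimum is a minimum. *)
Definition first_passage (x : G -> R) (n : nat) : R :=
  inf [set passage_time x v | v in [set v : G | depth v = n]].

End Passage.

Section Labels.
Context {d : measure_display} {T : measurableType d} {R : realType}.
Variable P : probability T R.

(* Mutual independence of the subfamily indexed by [D]. *)
Definition independent_on (I : eqType) (D : set I) (X : I -> {RV P >-> R}) : Prop :=
  forall (s : seq I) (B : I -> set R),
    uniq s -> (forall i, i \in s -> D i) ->
    (forall i, measurable (B i)) ->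
    P (\bigcap_(i in [set` s]) (X i @^-1` B i)) =
    (\prod_(i <- s) P (X i @^-1` B i))%E.

(* An exponential variable of rate 1, hence of mean 1. *)
Definition standard_exponential (X : {RV P >-> R}) : Prop :=
  forall A : set R, measurable A -> distribution P X A = exponential_prob 1 A.

Definition explosion (G : rooted_tree) (X : G -> {RV P >-> R}) : set T :=
  [set t | exists B : R, forall n, first_passage (fun v => X v t) n <= B].

End Labels.

Section Ftilde.
Variables (R : realType) (f : nat -> nat).

(* With [c] the product of the first [n] values, the next value. *)
Definition ftilde_next (n : nat) (c : R) : R :=
  sup [set a : R | 0 < a /\
    forall m, (1 <= m)%N -> a ^+ m * c <= \prod_(1 <= i < (n + m).+1) (f i)%:R].

Fixpoint ftilde_prod (n : nat) : R :=
  if n is k.+1 then ftilde_prod k * ftilde_next k (ftilde_prod k) else 1.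

(* The value at 0 is irrelevant; [ftildeS] is the defining recursion. *)
Definition ftilde (n : nat) : R := ftilde_next n.-1 (ftilde_prod n.-1).

Lemma ftilde_prodE n : ftilde_prod n = \prod_(1 <= i < n.+1) ftilde i.
Proof.
elim: n => [|n IHn]; first by rewrite big_nil.
by rewrite big_nat_recr //= -IHn.
Qed.

Lemma ftildeS n : ftilde n.+1 =
  sup [set a : R | 0 < a /\
    forall m, (1 <= m)%N ->
      a ^+ m * \prod_(1 <= i < n.+1) ftilde i
        <= \prod_(1 <= i < (n + m).+1) (f i)%:R].
Proof. by rewrite /ftilde /= ftilde_prodE. Qed.

End Ftilde.

(* Main.v *)
(* Write Z n = f 1 * ... * f n, the size of level n, and c n = ftilde 1 * ... * ftilde n. The
   logarithm of c is the greatest convex minorant of that of Z; so ftilde is nondecreasing, c <=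
   Z, with equality at n when ftilde n < ftilde n.+1, and Z n <= c n * (1 + e) ^ n for
   infinitely many n.

   Lower bound. A union bound shows that, for a < 1/e, almost surely every path of length n, n a
   large level with Z n <= c n * (1 + e) ^ n, has a weighted sum of ftilde(|w|) X(w) that
   exceeds a * n. Abel summation turns this into S(v) >= a * (1/ftilde 1 + ... + 1/ftilde n) -
   O(1): it uses the weighted sums only at n and at the levels where ftilde jumps, and there Z =
   c.

   Upper bound. For a > 1/e cut the levels after n into blocks of a fixed large length k, and
   keep the paths whose sum over each block is at most k * a / ftilde, taken at the first level
   of the block. A path passes the first j blocks with probability at least 2 ^ j times the
   product of the inverses of ftilde, so in the second moment the pairs of paths that separate
   at level m in block j contribute O(2 ^ - j / c n), because Z m >= c m; earlier or later
   branching of the tree does not matter. Hence the paths that are kept survive with probability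
   1 - O(1 / c n), and c n tends to infinity when ftilde is unbounded. *)
Require Import Defs.
From HB Require Import structures.
From mathcomp Require Import all_boot all_order all_algebra.
From mathcomp Require Import all_classical all_reals all_analysis.
From mathcomp Require Import measurable_realfun.
From mathcomp Require Import ring lra.
Import Order.TTheory GRing.Theory Num.Theory.
Import numFieldNormedType.Exports.
Local Open Scope classical_set_scope.
Local Open Scope ring_scope.

(** * The slopes of the convex minorant *)

(** The constant: on a path of length [n], the labels whose weighted sum is at most [a * n] form a
    simplex of volume [(a * n) ^ n / n! / c n], and the exponential density is at most 1. With about
    [c n] paths the expected number of slow exceptions is of the order of [(a * e) ^ n], up to the
    slack [(1 + e) ^ n]-type factors, so [1/e] is critical. The obstacle is that [Z] may exceed [c]
    by far on long stretches of levels. The lower bound is therefore obtained only along a sequence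
    of levels, whereas the upper bound holds at all large ones; this is the shape of a limit
    superior. In the second moment the density must also be bounded below. It is near 1 only if the
    caps are small, and they are of order [k / ftilde]; so an unbounded [ftilde] serves there as
    well as in making [c n] large. A cap on each block, rather than on the total, keeps the common
    part of two paths from being exceptionally fast. If the sum of the inverses is finite then
    [ftilde] is unbounded, so the same upper bound yields explosion. *)

Definition growth_prod (R : realType) (f : nat -> nat) (n : nat) : R :=
  \prod_(1 <= i < n.+1) (f i)%:R.

Section GrowthMinorant.
Context {R : realType} {f : nat -> nat}.
Hypothesis f_gt0 : forall n, (1 <= n)%N -> (1 <= f n)%N.

Local Notation phi := (ftilde R f).
Local Notation c := (ftilde_prod R f).
Local Notation Z := (growth_prod R f).

Definition ftilde_set (n : nat) : set R :=
  [set a | 0 < a /\ forall m, (1 <= m)%N -> a ^+ m * c n <= Z (n + m)].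

Lemma growth_prodS n : Z n.+1 = Z n * (f n.+1)%:R.
Proof. by rewrite /growth_prod big_nat_recr. Qed.

Lemma growth_prod_ge1 n : 1 <= Z n.
Proof.
elim: n => [|n IH]; first by rewrite /growth_prod big_geq.
rewrite growth_prodS -[leLHS]mulr1 ler_pM// (ler_nat _ 1).
exact: f_gt0.
Qed.

Lemma growth_prod_gt0 n : 0 < Z n.
Proof. exact: lt_le_trans (growth_prod_ge1 n). Qed.

Lemma ftilde_set_sup n : 0 < c n -> ftilde_set n !=set0 -> has_sup (ftilde_set n).
Proof.
move=> c0 S0; split => //; exists (Z n.+1 / c n) => a [a0 /(_ 1%N isT)].
by rewrite expr1 addn1 ler_pdivlMr.
Qed.

(** Each condition [a ^+ m * c n <= Z (n + m)] is closed in [a], and positivity survives because the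
    supremum dominates an element; so the supremum is attained. *)
Lemma ftilde_set_closed n : 0 < c n -> ftilde_set n !=set0 ->
  ftilde_set n (sup (ftilde_set n)).
Proof.
move=> c0 S0; have hs := ftilde_set_sup _ c0 S0; split.
  have [a aS] := S0; apply: lt_le_trans (proj1 aS) _.
  exact: (ub_le_sup (proj2 hs)).
move=> m m1; pose K := (fun a : R => a ^+ m) @^-1` [set x | x <= Z (n + m) / c n].
have /closure_id cKE : closed K.
  apply: preimage_closed (@closed_le _ _) => a _; exact: exprn_continuous.
suff : K (sup (ftilde_set n)) by rewrite /K /= ler_pdivlMr.
rewrite cKE; apply: closure_subset (closure_sup S0 (proj2 hs)) => a [_].
by move=> /(_ m m1); rewrite /K /= ler_pdivlMr.
Qed.

(** The two claims need a joint induction: the attained supremum at step [n] makes [c n.+1] positive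
    and is itself admissible at step [n.+1], by the condition with exponent [m.+1]. The same remark
    gives the monotonicity of [ftilde] in [ftilde_leS]. *)
Lemma ftilde_set_prod n : 0 < c n /\ ftilde_set n !=set0.
Proof.
elim: n => [|n [c0 S0]].
  split; first by rewrite /= ltr01.
  exists 1; split => // m _; rewrite expr1n mulr1 add0n; exact: growth_prod_ge1.
have [a0 aZ] := ftilde_set_closed _ c0 S0.
have cS : c n.+1 = c n * sup (ftilde_set n) by [].
split; first by rewrite cS mulr_gt0.
exists (sup (ftilde_set n)); split=> // m m1.
by rewrite cS mulrCA -exprSr mulrC addSnnS aZ.
Qed.

Lemma ftilde_prod_gt0 n : 0 < c n. Proof. by have [] := ftilde_set_prod n. Qed.

Lemma ftilde_mem n : ftilde_set n (phi n.+1).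
Proof. by have [c0 S0] := ftilde_set_prod n; exact: ftilde_set_closed. Qed.

Lemma ftilde_max n a : 0 < a ->
  (forall m, (1 <= m)%N -> a ^+ m * c n <= Z (n + m)) -> a <= phi n.+1.
Proof.
move=> a0 aZ; have [c0 S0] := ftilde_set_prod n.
by apply: (ub_le_sup (proj2 (ftilde_set_sup _ c0 S0))).
Qed.

Lemma ftilde_prodS n : c n.+1 = c n * phi n.+1. Proof. by []. Qed.

Lemma ftilde_gt0 n : (0 < n)%N -> 0 < phi n.
Proof. by case: n => // n _; have [] := ftilde_mem n. Qed.

Lemma ftilde_expr_le n m : phi n.+1 ^+ m * c n <= Z (n + m).
Proof.
case: m => [|m]; last by have [_] := ftilde_mem n; exact.
rewrite mul1r addn0; case: n => [|n]; first exact: growth_prod_ge1.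
have [_ /(_ 1%N isT)] := ftilde_mem n.
by rewrite expr1 addn1 mulrC.
Qed.

Lemma ftilde_prod_le n : c n <= Z n.
Proof. by have := ftilde_expr_le n 0; rewrite mul1r addn0. Qed.

Lemma ftilde_leS n : phi n.+1 <= phi n.+2.
Proof.
apply: ftilde_max => [|m m1]; first exact: ftilde_gt0.
by rewrite ftilde_prodS mulrCA -exprSr mulrC addSnnS ftilde_expr_le.
Qed.

Lemma ftilde_le m n : (0 < m)%N -> (m <= n)%N -> phi m <= phi n.
Proof.
case: m => // m _; elim: n => // n IH; rewrite leq_eqVlt => /predU1P[->//|].
by case: n IH => // n IH mn; rewrite (le_trans (IH _)) ?ftilde_leS.
Qed.

Lemma ftilde_ge1 n : (0 < n)%N -> 1 <= phi n.
Proof.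
move=> n0; apply: le_trans (ftilde_le 1 n isT n0).
apply: ftilde_max => // m _; rewrite expr1n mulr1; exact: growth_prod_ge1.
Qed.

Lemma ftilde_prodD_ge n m : phi n.+1 ^+ m * c n <= c (n + m).
Proof.
elim: m => [|m IH]; first by rewrite mul1r addn0.
rewrite addnS ftilde_prodS exprS -mulrA mulrC.
apply: ler_pM => //.
- by rewrite mulr_ge0 ?exprn_ge0 // ltW ?ftilde_gt0 ?ftilde_prod_gt0.
- by rewrite ltW ?ftilde_gt0.
- by apply: ftilde_le => //; rewrite ltnS leq_addr.
Qed.

(* If [c m < Z m], a value slightly above [phi m] is still admissible at step [m]. *)
Lemma ftilde_jump m : (0 < m)%N -> phi m < phi m.+1 -> Z m = c m.
Proof.
case: m => // m _ jump; apply/eqP; rewrite eq_sym eq_le ftilde_prod_le /=.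
rewrite leNgt; apply/negP => cZ.
have b0 := ftilde_gt0 m.+1 isT; have a0 := ftilde_gt0 m.+2 isT.
have cm0 := ftilde_prod_gt0 m.
(* The second entry makes [s] admissible for exponent 1. For exponent [j.+2], [s ^+ 2] is at most
   the product of the two slopes and the other factors are at most [phi m.+2], which reduces to
   admissibility of [phi m.+2] one step later. Both entries exceed [phi m.+1]. *)
pose s := Num.min (Num.sqrt (phi m.+2 * phi m.+1)) (Z m.+1 / c m).
suff : s <= phi m.+1.
  have r1 : phi m.+1 < Num.sqrt (phi m.+2 * phi m.+1).
    rewrite -[ltLHS](ger0_norm (ltW b0)) -sqrtr_sqr ltr_sqrt ?mulr_gt0 //.
    by rewrite expr2 ltr_pM2r.
  by rewrite ge_min (leNgt _ (phi m.+1)) r1 /= ler_pdivrMr // mulrC -ftilde_prodS leNgt cZ.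
have s0 : 0 < s by rewrite lt_min sqrtr_gt0 !(mulr_gt0, invr_gt0, growth_prod_gt0).
apply: ftilde_max => // -[//|[|j]] _.
  by rewrite expr1 addn1 -ler_pdivlMr // ge_min lexx orbT.
have sa : s <= Num.sqrt (phi m.+2 * phi m.+1) by rewrite ge_min lexx.
have s2 : s ^+ 2 <= phi m.+2 * phi m.+1.
  rewrite -(sqr_sqrtr (ltW (mulr_gt0 a0 b0))).
  by rewrite lerXn2r ?nnegrE ?sqrtr_ge0 ?(ltW s0).
have sphi : s <= phi m.+2.
  rewrite -(ler_pXn2r (n := 2)) ?nnegrE ?(ltW s0) ?(ltW a0) //.
  by rewrite (le_trans s2) // expr2 ler_pM2l // ltW.
apply: (@le_trans _ _ (phi m.+2 ^+ j.+1 * c m.+1)); last first.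
  by rewrite -addSnnS ftilde_expr_le.
rewrite ftilde_prodS.
have -> : phi m.+2 ^+ j.+1 * (c m * phi m.+1) =
  phi m.+2 ^+ j * (phi m.+2 * phi m.+1) * c m by rewrite exprSr; ring.
rewrite -addn2 exprD ler_pM2r // ler_pM ?exprn_ge0 ?(ltW s0) //.
by case: j => // j; rewrite lerXn2r ?nnegrE ?(ltW s0) ?(ltW a0).
Qed.

(** Otherwise [phi N.+1 * (1 + e)] would be admissible at step [N], against maximality: [c (N + m)]
    is at least [phi N.+1 ^+ m * c N], and the surplus at level [N + m] covers [(1 + e) ^+ m]. *)
Lemma growth_prod_close_io (e : R) (N : nat) : 0 < e ->
  exists2 n, (N <= n)%N & Z n <= c n * (1 + e) ^+ n.
Proof.
move=> e0; apply: contrapT => noN.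
have far n : (N <= n)%N -> c n * (1 + e) ^+ n < Z n.
  by move=> Nn; rewrite ltNge; apply/negP => ?; apply: noN; exists n.
have p0 := ftilde_gt0 N.+1 isT.
suff : phi N.+1 * (1 + e) <= phi N.+1.
  by rewrite -[leRHS]mulr1 ler_pM2l // gerDl leNgt e0.
apply: ftilde_max => [|m m1]; first by rewrite mulr_gt0 // addr_gt0.
apply: le_trans (ltW (far (N + m)%N (leq_addr _ _))).
rewrite exprMn mulrAC mulrC [leRHS]mulrC.
have e1 : 1 <= 1 + e by rewrite lerDl ltW.
rewrite ler_pM ?exprn_ge0 ?(le_trans _ e1) //.
- by rewrite mulr_ge0 ?exprn_ge0 ?ltW // ?ftilde_prod_gt0.
- by rewrite ler_weXn2l // leq_addl.
- exact: ftilde_prodD_ge.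
Qed.

End GrowthMinorant.

(** * Abel summation and factorial bounds *)

Section AbelSummation.
Context {R : realType}.

Lemma abel_summation (b u : nat -> R) n :
  \sum_(0 <= i < n.+1) b i * u i =
  b n * \sum_(0 <= i < n.+1) u i +
  \sum_(0 <= j < n) (b j - b j.+1) * \sum_(0 <= i < j.+1) u i.
Proof.
elim: n => [|n IH]; first by rewrite !big_nat1 big_geq ?addr0.
rewrite big_nat_recr //= IH.
rewrite [X in _ = X + _](_ : _ = b n.+1 * (\sum_(0 <= i < n.+1) u i + u n.+1)); last first.
  by congr (_ * _); rewrite big_nat_recr.
rewrite [X in _ = _ + X]big_nat_recr //=.
by move: (\sum_(0 <= i < n.+1) u i) (\sum_(0 <= j < n) _) => S S'; ring.
Qed.

(** The coefficients [b j - b j.+1] are nonnegative and vanish unless [b] drops, so no other partial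
    sum needs control; together with [b n] they telescope to [b 0]. *)
Lemma abel_lower_bound (b u : nat -> R) (D : R) n :
  0 <= D -> (forall i, 0 <= b i) -> (forall i, b i.+1 <= b i) ->
  (forall j, (j < n)%N -> b j.+1 < b j -> - D <= \sum_(0 <= i < j.+1) u i) ->
  - D <= \sum_(0 <= i < n.+1) u i ->
  - (D * b 0%N) <= \sum_(0 <= i < n.+1) b i * u i.
Proof.
move=> D0 b0 bS Uj Un; rewrite abel_summation.
apply: le_trans (_ : _ <= b n * (- D) + \sum_(0 <= j < n) (b j - b j.+1) * (- D)) _.
  by rewrite -mulr_suml (telescope_sumr_eq (fun i => - b i)) // => [|i _]; [lra|ring].
apply: lerD; first exact: ler_wpM2l.
rewrite big_nat_cond [leRHS]big_nat_cond; apply: ler_sum => j /andP[/andP[_ jn] _].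
have := bS j; rewrite le_eqVlt => /predU1P[->|bj]; first by rewrite subrr !mul0r.
by rewrite ler_wpM2l ?Uj // subr_ge0 ltW.
Qed.

End AbelSummation.

Section FactorialBounds.
Context {R : realType}.

Lemma exprnn_le_fact m : (m%:R : R) ^+ m <= expR 1 ^+ m * m`!%:R.
Proof.
elim: m => [|m IH]; first by rewrite !expr0 mul1r.
have [->|m0] := posnP m; first by rewrite !expr1 mulr1 -[leLHS]expR0 ler_expR.
have mR : 0 < (m%:R : R) by rewrite ltr0n.
have e1 : (1 + m%:R^-1) ^+ m <= expR 1 :> R.
  rewrite [leRHS](_ : _ = expR m%:R^-1 ^+ m); last first.
    by rewrite -expRM_natl mulfV ?gt_eqF.
  by rewrite lerXn2r ?nnegrE ?addr_ge0 ?expR_ge0 ?expR_ge1Dx // invr_ge0 ltW.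
have -> : m.+1%:R ^+ m.+1 = m.+1%:R * m%:R ^+ m * (1 + m%:R^-1) ^+ m :> R.
  rewrite -mulrA -exprMn mulrDr mulr1 mulfV ?gt_eqF // exprS.
  by rewrite -natr1.
rewrite exprSr factS natrM.
rewrite [leRHS](_ : _ = m.+1%:R * (expR 1 ^+ m * m`!%:R) * expR 1); last by ring.
by rewrite !ler_pM ?mulr_ge0 ?exprn_ge0 ?addr_ge0 ?invr_ge0.
Qed.

Lemma fact_le_exprnn k : (0 < k)%N ->
  expR 1 ^+ k * k`!%:R <= expR 1 * (k%:R : R) ^+ k.+1.
Proof.
elim: k => // k IH _; have [->|k0] := posnP k.
  by rewrite expr1n expr1 !mulr1.
have kR : 0 < (k%:R : R) by rewrite ltr0n.
have k1R : 0 < (k.+1%:R : R) by rewrite ltr0n.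
(* This is [e <= (1 + 1/k) ^ (k+1)], obtained from [1 - 1/(k+1) <= exp (- 1/(k+1))]. *)
have e1 : expR 1 * k%:R ^+ k.+1 <= k.+1%:R ^+ k.+1 :> R.
  rewrite -ler_pdivlMl ?expR_gt0 // -expRN.
  rewrite -ler_pdivrMr ?exprn_gt0 // -expr_div_n.
  rewrite [leRHS](_ : _ = expR (- k.+1%:R^-1) ^+ k.+1); last first.
    by rewrite -expRM_natl mulrN mulfV ?gt_eqF.
  rewrite lerXn2r ?nnegrE ?divr_ge0 ?expR_ge0 //; last first.
  apply: le_trans (expR_ge1Dx _).
  by rewrite ler_pdivrMr // mulrDl mulNr mulVf ?gt_eqF // mul1r -natr1 addrK.
rewrite factS natrM exprS.
rewrite [leLHS](_ : _ = expR 1 * k.+1%:R * (expR 1 ^+ k * k`!%:R)); last by ring.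
apply: le_trans (_ : _ <= expR 1 * k.+1%:R * (expR 1 * k%:R ^+ k.+1)) _.
  by rewrite ler_pM2l ?IH // mulr_gt0 ?expR_gt0.
by rewrite -mulrA (exprS _ k.+1) ler_pM2l ?expR_gt0 // ler_pM2l.
Qed.

(* By Stirling's formula [(k * c) ^ k / k!] is of the order of [(c * e) ^ k / sqrt k]. *)
Lemma block_length (c : R) : expR (-1) < c ->
  exists2 k, (0 < k)%N & 1 <= k%:R * c /\ 4 * k`!%:R <= (k%:R * c) ^+ k.
Proof.
move=> ec; have c0 : 0 < c := lt_trans (expR_gt0 _) ec.
pose d := c * expR 1 - 1.
have d0 : 0 < d.
  by rewrite subr_gt0 -ltr_pdivrMr ?expR_gt0 // mul1r -expRN.
(* With [k = 2 * j] and [c * e = 1 + d], Bernoulli on each half gives [(1 + d) ^ k >= (j * d) ^ 2],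
   quadratic in [j], against the linear loss [4 * e * k] of [fact_le_exprnn]. The last summand of
   [q] makes [j * d ^ 2] at least [8 * e]; the middle one gives [1 <= j * c]. *)
pose q := 1 + c^-1 + 8 * expR 1 / d ^+ 2.
have q0 : 0 < q.
  by rewrite !addr_gt0 ?invr_gt0 // divr_gt0 ?exprn_gt0 // mulr_gt0 // expR_gt0.
pose j := (Num.truncn q).+1.
have qj : q < j%:R by apply: truncnS_gt.
have jR : 0 < (j%:R : R) by rewrite ltr0n.
have jc : 1 <= j%:R * c.
  rewrite -ler_pdivrMr // mul1r (le_trans _ (ltW qj)) // /q addrAC lerDr.
  by rewrite addr_ge0 // ltW // divr_gt0 ?exprn_gt0 // mulr_gt0 // expR_gt0.
have jd : 8 * expR 1 <= j%:R * d ^+ 2.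
  rewrite -ler_pdivrMr ?exprn_gt0 // (le_trans _ (ltW qj)) // /q lerDr.
  by rewrite addr_ge0 // invr_ge0 ltW.
exists (j + j)%N => //; split; first by rewrite natrD mulrDl (le_trans jc) // lerDl mulr_ge0 // ltW.
have bern n : 1 + n%:R * d <= (1 + d) ^+ n.
  elim: n => [|n IH]; first by rewrite mul0r addr0.
  rewrite exprSr; apply: le_trans (_ : _ <= (1 + n%:R * d) * (1 + d)) _.
    rewrite -natr1 -subr_ge0.
    have -> : (1 + n%:R * d) * (1 + d) - (1 + (n%:R + 1) * d) = n%:R * d ^+ 2 by ring.
    by rewrite mulr_ge0 // exprn_ge0 // ltW.
  by rewrite ler_pM2r // addr_gt0.
have ce : c * expR 1 = 1 + d by rewrite /d addrC subrK.
set k := (j + j)%N.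
have kR : 0 < (k%:R : R) by rewrite ltr0n /k.
have growth : 4 * expR 1 * k%:R <= (c * expR 1) ^+ k.
  rewrite ce /k exprD; apply: le_trans (_ : _ <= (j%:R * d) * (j%:R * d)) _.
    rewrite natrD; have := jd; rewrite -(ler_pM2r jR) => h.
    rewrite [leRHS](_ : _ = j%:R * d ^+ 2 * j%:R); last by ring.
    by rewrite [leLHS](_ : _ = 8 * expR 1 * j%:R); last by ring.
  have jj : j%:R * d <= (1 + d) ^+ j by rewrite (le_trans _ (bern j)) // lerDr.
  by rewrite ler_pM // mulr_ge0 // ltW.
have ek : 0 < (expR 1 : R) ^+ k by rewrite exprn_gt0 ?expR_gt0.
rewrite -(ler_pM2r ek).
have h := ler_wpM2l (ler0n R 4) (fact_le_exprnn k isT).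
apply: le_trans (_ : _ <= 4 * expR 1 * k%:R * k%:R ^+ k) _.
  apply: le_trans (_ : _ <= 4 * (expR 1 ^+ k * k`!%:R)) _; first by rewrite mulrAC mulrA.
  by rewrite (le_trans h) // exprS !mulrA.
apply: le_trans (_ : _ <= (c * expR 1) ^+ k * k%:R ^+ k) _.
  by rewrite ler_pM2r // exprn_gt0.
by rewrite !exprMn mulrAC [c ^+ k * _]mulrC.
Qed.

End FactorialBounds.

(** * Independence of sums over disjoint groups *)

Section IndependenceFromEvent.
Context {d : measure_display} {T : measurableType d} {R : realType}.
Variable P : probability T R.

(** Two finite measures on the plane are compared: the law of the pair restricted to [C], and the
    law of the pair scaled by [P C]. They agree on rectangles, which are stable under intersection
    and generate. *)
Lemma pair_indep_event (X Y : T -> R) (C : set T) (E : set (R * R)) :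
  measurable_fun setT X -> measurable_fun setT Y -> measurable C ->
  (forall A B, measurable A -> measurable B ->
    P (X @^-1` A `&` Y @^-1` B `&` C) = (P (X @^-1` A `&` Y @^-1` B) * P C)%E) ->
  measurable E ->
  P ((fun t => (X t, Y t)) @^-1` E `&` C) =
  (P ((fun t => (X t, Y t)) @^-1` E) * P C)%E.
Proof.
move=> mX mY mC indepC mE.
have mXY : measurable_fun setT (fun t => (X t, Y t)) by exact: measurable_fun_pair.
have PC0 : 0 <= fine (P C) by rewrite fine_ge0.
pose r : {nonneg R} := NngNum PC0.
pose XY t := (X t, Y t).
have [m1 m1E] : exists m1 : {measure set (R * R)%type -> \bar R},
  forall A, m1 A = P (XY @^-1` A `&` C).
  pose m : {measure set (R * R)%type -> \bar R} :=
    pushforward (mrestr P mC) XY.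
  by exists (m mXY).
have [m2 m2E] : exists m2 : {measure set (R * R)%type -> \bar R},
  forall A, m2 A = (P (XY @^-1` A) * P C)%E.
  pose m : {measure set (R * R)%type -> \bar R} :=
    mscale r (pushforward P XY).
  exists (m mXY) => A; rewrite muleC -[P C]fineK ?fin_num_measure //.
rewrite -m2E -m1E.
apply: (measure_unique [set A `*` B | A in measurable & B in measurable] (fun=> setT)) => //.
- exact: measurable_prod_measurableType.
- move=> _ _ [A mA [B mB <-]] [A' mA' [B' mB' <-]].
  exists (A `&` A'); first exact: measurableI.
  exists (B `&` B'); first exact: measurableI.
  by rewrite setXI.
- by move=> _; exists setT => //; exists setT => //; rewrite setXTT.
- by rewrite bigcup_const.
- by move=> _ [A mA [B mB <-]]; rewrite m1E m2E; exact: indepC.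
- move=> _; rewrite m1E preimage_setT setTI.
  by rewrite ltey_eq fin_num_measure.
Qed.

End IndependenceFromEvent.

Section GroupIndependence.
Context {d : measure_display} {T : measurableType d} {R : realType}.
Variable P : probability T R.
Variables (I : choiceType) (D : set I) (X : I -> {RV P >-> R}).
Hypothesis X_indep : independent_on D X.

Definition wsum (a : I -> R) (g : seq I) (t : T) : R := \sum_(v <- g) a v * X v t.

Lemma measurable_wsum a g : measurable_fun setT (wsum a g).
Proof.
rewrite /wsum; apply: measurable_sum => v; exact: measurable_funM.
Qed.

Lemma measurable_wsum_pre a g B : measurable B -> measurable (wsum a g @^-1` B).
Proof. by move=> mB; rewrite -[_ @^-1` _]setTI; exact: measurable_wsum. Qed.

Local Notation gev a gs :=
  (\big[setI/setT]_(g <- gs) (wsum a g.1 @^-1` g.2)).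

Lemma measurable_gev a (gs : seq (seq I * set R)) :
  (forall g, g \in gs -> measurable g.2) -> measurable (gev a gs).
Proof.
elim: gs => [|g gs IH] mg; first by rewrite big_nil.
rewrite big_cons; apply: measurableI.
  by apply: measurable_wsum_pre; apply: mg; rewrite inE eqxx.
by apply: IH => h hg; apply: mg; rewrite inE hg orbT.
Qed.

Local Notation sev ss := (\big[setI/setT]_(s <- ss) (X s.1 @^-1` s.2)).

Lemma measurable_sev (ss : seq (I * set R)) :
  (forall s, s \in ss -> measurable s.2) -> measurable (sev ss).
Proof.
elim: ss => [|s ss IH] ms; first by rewrite big_nil.
rewrite big_cons; apply: measurableI.
  by rewrite -[X in measurable X]setTI; apply: measurable_funPT => //; apply: ms; rewrite inE eqxx.
by apply: IH => h hs; apply: ms; rewrite inE hs orbT.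
Qed.

Lemma single_indep (ss : seq (I * set R)) :
  uniq (unzip1 ss) -> (forall v, v \in unzip1 ss -> D v) ->
  (forall s, s \in ss -> measurable s.2) ->
  P (sev ss) = (\prod_(s <- ss) P (X s.1 @^-1` s.2))%E.
Proof.
(* The indices are distinct, so the list determines a function from indices to sets, with the whole
   line as default off the list; this is the form used by [independent_on]. *)
move=> us Ds ms; pose B i := (nth (i, setT) ss (index i (unzip1 ss))).2.
have mB i : measurable (B i).
  rewrite /B; have [|] := ltnP (index i (unzip1 ss)) (size ss).
    by move=> lt; apply: ms; rewrite mem_nth.
  by move=> le; rewrite nth_default //=; exact: measurableT.
have BE s : s \in ss -> B s.1 = s.2.
  move=> ins; have si : (index s ss < size ss)%N by rewrite index_mem.
  have sE : nth s.1 (unzip1 ss) (index s ss) = s.1 by rewrite (nth_map s) // nth_index.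
  by rewrite /B -[in index _ _]sE index_uniq ?size_map // (set_nth_default s) // nth_index.
have := X_indep _ _ us Ds mB; rewrite bigcap_seq !big_map => h.
have E1 : sev ss = \big[setI/setT]_(s <- ss) (X s.1 @^-1` B s.1).
  by apply: eq_big_seq => s ins; rewrite BE.
by rewrite E1 h; apply: eq_big_seq => s ins; rewrite BE.
Qed.

Lemma wsum_cons a v g : wsum a (v :: g) = fun t => a v * X v t + wsum a g t.
Proof. by apply/funext => t; rewrite /wsum big_cons. Qed.

(* The single variables [ss] allow a group to be peeled off one variable at a time. *)
Definition split_indep a gs := forall ss : seq (I * set R),
  uniq (flatten (unzip1 gs) ++ unzip1 ss) ->
  (forall v, v \in flatten (unzip1 gs) ++ unzip1 ss -> D v) ->
  (forall s, s \in ss -> measurable s.2) ->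
  P (gev a gs `&` sev ss) =
  (\prod_(g <- gs) P (wsum a g.1 @^-1` g.2) *
   \prod_(s <- ss) P (X s.1 @^-1` s.2))%E.

Lemma split_indep_nil a : split_indep a [::].
Proof. by move=> ss us Ds ms; rewrite !big_nil setTI mul1e; exact: single_indep. Qed.

(** Induction on [g]: for a rectangle, the condition on the head [v] is moved into [ss], where
    [split_indep] and the induction hypothesis for the tail apply. [pair_indep_event] then passes
    from rectangles to the half of the plane, or any other set, cut out by [a v * x + y]. *)
Lemma wsum_indep_event a (g : seq I) (gs : seq (seq I * set R)) :
  (forall h, h \in gs -> measurable h.2) -> split_indep a gs ->
  forall (ss : seq (I * set R)) B, measurable B ->
  uniq (g ++ flatten (unzip1 gs) ++ unzip1 ss) ->
  (forall v, v \in g ++ flatten (unzip1 gs) ++ unzip1 ss -> D v) ->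
  (forall s, s \in ss -> measurable s.2) ->
  P (wsum a g @^-1` B `&` (gev a gs `&` sev ss)) =
  (P (wsum a g @^-1` B) * P (gev a gs `&` sev ss))%E.
Proof.
elim: g gs => [|v g IH] gs mgs Qgs ss B mB us Ds ms.
  have wE t : wsum a [::] t = 0 by rewrite /wsum big_nil.
  have [B0|nB0] := pselect (B 0).
    have -> : wsum a [::] @^-1` B = setT by apply/seteqP; split => t //= _; rewrite wE.
    by rewrite setTI probability_setT mul1e.
  have -> : wsum a [::] @^-1` B = set0.
    by apply/seteqP; split => t //=; rewrite wE.
  by rewrite set0I measure0 mul0e.
have pm (G F S : seq I) : perm_eq (G ++ F ++ v :: S) (v :: G ++ F ++ S).
  by rewrite catA -cat1s perm_catCA /= catA.
pose E : set (R * R) := (fun p => a v * p.1 + p.2) @^-1` B.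
have mE : measurable E.
  have mh : measurable_fun setT (fun p : R * R => a v * p.1 + p.2).
    apply: measurable_funD => //.
    by apply: measurable_funM => //; exact: measurable_fst.
  by rewrite -[E]setTI; exact: mh.
have -> : wsum a (v :: g) @^-1` B = (fun t => (X v t, wsum a g t)) @^-1` E.
  by rewrite wsum_cons.
apply: pair_indep_event => //; first exact: measurable_wsum.
  by apply: measurableI; [exact: measurable_gev|exact: measurable_sev].
move=> A A' mA mA'.
have mssA : forall s, s \in (v, A) :: ss -> measurable s.2.
  by move=> s; rewrite inE => /predU1P[->//|]; exact: ms.
have E1 : P (X v @^-1` A `&` wsum a g @^-1` A') = (P (wsum a g @^-1` A') * P (X v @^-1` A))%E.
  have := @IH [::] _ (split_indep_nil a) [:: (v, A)] A' mA'.
  rewrite /= !big_nil !big_cons !big_nil !setTI !setIT => <- //.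
  - by rewrite setIC.
  - rewrite (perm_uniq (pm g [::] [::])) /= cats0.
    by move: us; rewrite /= mem_cat cat_uniq => /andP[/norP[-> _] /andP[->]].
  - move=> w; rewrite (perm_mem (pm g [::] [::])) /= cats0 => win; apply: Ds.
    by rewrite mem_cat win.
  - by move=> s; rewrite inE => /eqP ->.
have E2 : P (gev a gs `&` sev ((v, A) :: ss)) = (P (X v @^-1` A) * P (gev a gs `&` sev ss))%E.
  rewrite !Qgs //.
  - by rewrite big_cons muleCA.
  - have /= -> := perm_uniq (pm [::] (flatten (unzip1 gs)) (unzip1 ss)).
    move: us; rewrite /= mem_cat cat_uniq.
    by case/andP => /norP[_ ->] /and3P[].
  - move=> w; have /= -> := perm_mem (pm [::] (flatten (unzip1 gs)) (unzip1 ss)).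
    by move=> win; apply: Ds; move: win; rewrite /= !inE !mem_cat => /orP[->//|/orP[]->];
      rewrite !orbT.
  - by move: us; rewrite cat_uniq => /and3P[].
  - by move=> w win; apply: Ds; rewrite mem_cat win orbT.
have E3 : X v @^-1` A `&` wsum a g @^-1` A' `&` (gev a gs `&` sev ss) =
    wsum a g @^-1` A' `&` (gev a gs `&` sev ((v, A) :: ss)).
  by rewrite big_cons /= [X v @^-1` A `&` _]setIC -setIA; congr (_ `&` _); rewrite setICA.
rewrite E3 IH // ?E2 ?E1 ?muleA //.
- have /= -> := perm_uniq (pm g (flatten (unzip1 gs)) (unzip1 ss)).
  exact: us.
- by move=> w; have /= -> := perm_mem (pm g (flatten (unzip1 gs)) (unzip1 ss)); exact: Ds.
Qed.

Lemma split_indepT a gs : (forall g, g \in gs -> measurable g.2) -> split_indep a gs.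
Proof.
elim: gs => [|[g B] gs IH] mgs; first exact: split_indep_nil.
have mgs' h : h \in gs -> measurable h.2 by move=> hg; apply: mgs; rewrite inE hg orbT.
move=> ss us Ds ms; have us' := us; move: us'; rewrite /= -catA => us'.
rewrite !big_cons -setIA wsum_indep_event //=.
- rewrite IH ?muleA //.
  + by move: us'; rewrite cat_uniq => /and3P[].
  + by move=> v vin; apply: Ds; rewrite /= -catA mem_cat vin orbT.
- exact: IH.
- by apply: (mgs (g, B)); rewrite inE eqxx.
- by move=> v vin; apply: Ds; rewrite /= -catA.
Qed.

Lemma group_indep a (gs : seq (seq I * set R)) :
  uniq (flatten (unzip1 gs)) -> (forall v, v \in flatten (unzip1 gs) -> D v) ->
  (forall g, g \in gs -> measurable g.2) ->
  P (gev a gs) = (\prod_(g <- gs) P (wsum a g.1 @^-1` g.2))%E.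
Proof.
move=> us Ds mgs; have := split_indepT a _ mgs [::].
by rewrite !big_nil setIT mule1 /= cats0; apply.
Qed.

End GroupIndependence.

(** * Convolution with an exponential variable *)

Section DensityIntegral.
Local Open Scope ereal_scope.
Context {d : measure_display} {T : measurableType d} {R : realType}.
Variables (mu nu : {measure set T -> \bar R}) (g : T -> R).
Hypotheses (mg : measurable_fun setT g) (g0 : forall x, (0 <= g x)%R).
Hypothesis nuE : forall A, measurable A -> nu A = \int[mu]_(x in A) (g x)%:E.

Import HBNNSimple.

Lemma density_integral_nnsfun (h : {nnsfun T >-> R}) :
  \int[nu]_x (h x)%:E = \int[mu]_x ((h x)%:E * (g x)%:E).
Proof.
under [LHS]eq_integral do rewrite fimfunE -fsumEFin//.
rewrite [LHS]ge0_integral_fsum//; last 2 first.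
  - by move=> r; exact/measurable_EFinP/measurableT_comp.
  - by move=> n x _; rewrite EFinM nnfun_muleindic_ge0.
under [RHS]eq_integral.
  move=> x xD; rewrite fimfunE -fsumEFin// ge0_mule_fsuml; last first.
    by move=> r; rewrite EFinM nnfun_muleindic_ge0.
  over.
rewrite [RHS]ge0_integral_fsum//; last 2 first.
  - move=> r; apply: emeasurable_funM; apply/measurable_EFinP => //.
    exact: measurableT_comp.
  - move=> n x _; apply: mule_ge0; last by rewrite lee_fin.
    by rewrite EFinM nnfun_muleindic_ge0.
apply: eq_fsbigr => r _.
rewrite integralZl_indic_nnsfun // integral_indic // setIT nuE //.
under [RHS]eq_integral do rewrite EFinM -muleA.
have mgi : measurable_fun setT (fun x => (\1_(h @^-1` [set r]) x)%:E * (g x)%:E).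
  by apply: emeasurable_funM; exact/measurable_EFinP.
have gi0 x : 0 <= (\1_(h @^-1` [set r]) x)%:E * (g x)%:E by rewrite mule_ge0 ?lee_fin.
have ie : \int[mu]_(x in h @^-1` [set r]) (g x)%:E =
    \int[mu]_x ((\1_(h @^-1` [set r]) x)%:E * (g x)%:E).
  rewrite [LHS]integral_mkcond; apply: eq_integral => x _.
  by rewrite patchE indicE; case: ifP => _; rewrite ?mul1e ?mul0e.
have [r0|r0] := leP 0%R r.
  by rewrite ie ge0_integralZl.
have -> : h @^-1` [set r] = set0.
  by apply: preimage_nnfun0.
rewrite integral_set0 mule0 integral0_eq // => x _.
by rewrite indic0 mul0e mule0.
Qed.

(** Applied with the exponential law as [nu], it turns the slice integral of a convolution into a
    Lebesgue integral. *)
Lemma density_integral (f : T -> \bar R) :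
  measurable_fun setT f -> (forall x, 0 <= f x) ->
  \int[nu]_x f x = \int[mu]_x (f x * (g x)%:E).
Proof.
move=> mf f0.
pose f_ := nnsfun_approx measurableT mf.
transitivity (limn (fun n => \int[nu]_x (f_ n x)%:E)).
  rewrite -monotone_convergence//=.
  - apply: eq_integral => ? /[!inE] xD; apply/esym/cvg_lim => //=.
    exact: cvg_nnsfun_approx.
  - by move=> n; exact/measurable_EFinP/measurable_funTS.
  - by move=> n ? _; rewrite lee_fin.
  - by move=> ? _ ? ? mn; rewrite lee_fin; exact/lefP/nd_nnsfun_approx.
under eq_fun do rewrite density_integral_nnsfun.
rewrite -monotone_convergence//=.
- apply: eq_integral => ? /[!inE] xD; apply/cvg_lim => //=.
  by apply: cvgeZr => //; exact: cvg_nnsfun_approx.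
- move=> n; apply: emeasurable_funM; last exact/measurable_EFinP.
  exact/measurable_EFinP/measurable_funTS.
- by move=> n ? _; rewrite mule_ge0 ?lee_fin.
- by move=> ? _ ? ? mn; rewrite lee_wpmul2r ?lee_fin //; exact/lefP/nd_nnsfun_approx.
Qed.

End DensityIntegral.

Section PolynomialIntegral.
Context {R : realType}.

Lemma is_derive_aff_pow (c a s : R) n (x : R) :
  is_derive x 1 (fun y : R => c * (s - a * y) ^+ n.+1)
    (- (c * a) * n.+1%:R * (s - a * x) ^+ n).
Proof.
have h : is_derive x 1 (cst s - a *: (id : R -> R)) (0 - a *: 1) by apply: is_deriveB.
have h2 := is_deriveZ c (is_deriveX n.+1 h).
have -> : (fun y : R => c * (s - a * y) ^+ n.+1) = c \*: ((cst s - a *: (id : R -> R)) ^+ n.+1).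
  by rewrite exprfctE.
apply: (is_derive_eq h2).
rewrite sub0r /= /GRing.scale /= mulr1.
rewrite (_ : (cst s - a *: id) x = s - a * x) //; ring.
Qed.

Lemma continuous_aff_pow (a s K : R) n :
  continuous (fun x : R => K * (s - a * x) ^+ n / n`!%:R).
Proof.
move=> x; case: n => [|n]; first exact: cst_continuous.
apply: differentiable_continuous; apply/derivable1_diffP.
have := is_derive_aff_pow (K / n.+1`!%:R) a s n x.
rewrite (_ : (fun y => _) = fun y => K * (s - a * y) ^+ n.+1 / n.+1`!%:R); first by case.
by apply/funext => y; ring.
Qed.

Lemma integral_aff_pow (a s K : R) n : 0 < a -> 0 <= s ->
  (\int[lebesgue_measure]_(x in `[0%R, (s / a)%R]) (K * (s - a * x) ^+ n / n`!%:R)%R%:E =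
   (K / a * s ^+ n.+1 / n.+1`!%:R)%R%:E)%E.
Proof.
move=> a0; rewrite le_eqVlt => /predU1P[<-|s0].
  by rewrite mul0r set_itv1 integral_set1 expr0n mulr0 mul0r.
have nf m : (m`!%:R : R) != 0 by rewrite pnatr_eq0 -lt0n fact_gt0.
have an : a != 0 by rewrite gt_eqF.
pose c : R := - (K / a) / n.+1`!%:R.
pose F (x : R) := c * (s - a * x) ^+ n.+1.
have dF (x : R) : is_derive x 1 F (K * (s - a * x) ^+ n / n`!%:R).
  apply: (is_derive_eq (is_derive_aff_pow c a s n x)).
  rewrite /c factS natrM; field.
  by rewrite an nf andbT gt_eqF // ltr_wpDr.
have cF : continuous F.
  move=> x; apply: differentiable_continuous; apply/derivable1_diffP.
  by have [] := dF x.
rewrite (@continuous_FTC2 _ _ F) //.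
- rewrite -EFinB; congr (_%:E).
  have sa : s - a * (s / a) = 0 by field.
  rewrite /F sa expr0n /= !mulr0 subr0 sub0r /c; ring.
- by rewrite divr_gt0.
- by apply: continuous_subspaceT; exact: continuous_aff_pow.
- split.
  + by move=> x _; have [] := dF x.
  + by apply/cvg_at_right_filter; exact: cF.
  + by apply/cvg_at_left_filter; exact: cF.
- by move=> x _; rewrite derive1E; have [_ ->] := dF x.
Qed.

End PolynomialIntegral.

Section Convolution.
Context {d : measure_display} {T : measurableType d} {R : realType}.
Variable P : probability T R.
Variables (X : {RV P >-> R}) (Y : T -> R).
Hypotheses (X_exp : standard_exponential X) (mY : measurable_fun setT Y).
Hypothesis XY_indep : forall A B, measurable A -> measurable B ->
  P (X @^-1` A `&` Y @^-1` B) = (P (X @^-1` A) * P (Y @^-1` B))%E.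

Local Notation leb_R := (measurableTypeR R).

Definition conv_region (a s : R) : set (leb_R * R) :=
  (fun p => a * (p.1 : R) + p.2) @^-1` `]-oo, s].

Lemma measurable_conv_region a s : measurable (conv_region a s).
Proof.
have mfst : measurable_fun setT (fun p : leb_R * R => p.1 : R) by exact: measurable_fst.
have mh : measurable_fun setT (fun p : leb_R * R => a * (p.1 : R) + p.2).
  by apply: measurable_funD => //; exact: measurable_funM.
by rewrite -[X in measurable X]setTI; exact: mh.
Qed.

(** By independence the law of [(X, Y)] is a product measure, and the half-plane is sliced at fixed
    [X]. Measurability of the slices is exported because the two estimates below compare
    integrals. *)
Lemma convolution_le (a s : R) :
  measurable_fun [set: leb_R] (fun x => P [set t | Y t <= s - a * x]) /\
  P [set t | a * X t + Y t <= s] =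
  (\int[lebesgue_measure]_x
    (P [set t | (Y t <= s - a * x)%R] * (exponential_pdf 1 x)%:E))%E.
Proof.
pose Ym : {mfun T >-> R} := HB.pack Y (isMeasurableFun.Build _ _ _ _ Y mY).
have mX : measurable_fun setT (X : T -> leb_R) by exact: (measurable_funP X).
have mXY : measurable_fun setT (fun t => (X t : leb_R, Y t)) by exact: measurable_fun_pair.
pose XY : {mfun T >-> (leb_R * R)%type} := HB.pack (fun t => (X t : leb_R, Y t))
  (isMeasurableFun.Build _ _ _ _ _ mXY).
have [m1 m1E] : exists m1 : probability leb_R R, forall A, m1 A = exponential_prob 1 A.
  pose m1 : probability leb_R R := exponential_prob 1.
  by exists (m1 ltr01).
pose m2 : probability _ R := distribution P Ym.
pose m : probability _ R := distribution P XY.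
have mE := measurable_conv_region a s.
have secE x : m2 (xsection (conv_region a s) x) = P [set t | Y t <= s - a * x].
  rewrite /m2 /= /distribution /pushforward; congr (P _).
  apply/seteqP; split => t /=; rewrite /xsection /= inE /conv_region /= in_itv /=;
    by rewrite lerBrDl.
have msec : measurable_fun [set: leb_R] (fun x => P [set t | Y t <= s - a * x]).
  rewrite (_ : (fun x => _) = m2 \o xsection (conv_region a s)).
    exact: measurable_fun_xsection.
  by apply/funext => x; rewrite -secE.
split => //.
have -> : P [set t | a * X t + Y t <= s] = m (conv_region a s).
  by rewrite (_ : [set t | _] = (fun t => (X t, Y t)) @^-1` conv_region a s).
rewrite -(product_measure_unique (m1 := m1) (m2 := m2)) //; last first.
  move=> A B mA mB; apply: (etrans (XY_indep _ _ mA mB)); congr (_ * _)%E.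
  exact: (etrans (X_exp _ mA) (esym (m1E A))).
rewrite /product_measure1 /=.
under eq_integral do rewrite secE.
apply: (density_integral lebesgue_measure m1 (exponential_pdf 1)) => //.
- exact: measurable_exponential_pdf.
- by move=> x; exact: exponential_pdf_ge0.
- by move=> A _; exact: m1E.
Qed.

(* The gamma distribution function of shape [n] lies between [expR (- u) * fact_pow n u] and
   [fact_pow n u]. *)
Definition fact_pow (n : nat) (u : R) : R := if 0 <= u then u ^+ n / n`!%:R else 0.

Lemma fact_pow_lt0 n u : u < 0 -> fact_pow n u = 0.
Proof. by move=> u0; rewrite /fact_pow leNgt u0. Qed.

Lemma fact_powE n u : 0 <= u -> fact_pow n u = u ^+ n / n`!%:R.
Proof. by move=> u0; rewrite /fact_pow u0. Qed.

(** The density is bounded by 1 on [[0, s / a]]; outside this interval the integrand vanishes. *)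
Lemma convolution_upper (a K : R) n : 0 < a -> 0 <= K ->
  (forall u, (P [set t | (Y t <= u)%R] <= (K * fact_pow n u)%:E)%E) ->
  forall s, (P [set t | (a * X t + Y t <= s)%R] <= (K / a * fact_pow n.+1 s)%:E)%E.
Proof.
move=> a0 K0 PY s; have [msec ->] := convolution_le a s.
have sect0 x : s < 0 \/ s / a < x -> (P [set t | (Y t <= s - a * x)%R] * (exponential_pdf 1 x)%:E
  = 0)%E.
  move=> sx; have [x0|x0] := ltP x 0; first by rewrite lt0_exponential_pdf // mule0.
  have sx0 : s - a * x < 0.
    case: sx => [s0|]; last by rewrite ltr_pdivrMr // mulrC subr_lt0.
    by rewrite subr_lt0 (lt_le_trans s0) // mulr_ge0 // ltW.
  have := PY (s - a * x); rewrite fact_pow_lt0 // mulr0 => P0.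
  by rewrite (_ : P _ = 0%E) ?mul0e //; apply/eqP; rewrite eq_le P0 measure_ge0.
have [s0|s0] := ltP s 0.
  rewrite integral0_eq => [|x _]; last by apply: sect0; left.
  by rewrite fact_pow_lt0 // mulr0.
rewrite fact_powE // mulrA -(integral_aff_pow a s K n a0 s0).
rewrite [leRHS]integral_mkcond; apply: ge0_le_integral => //.
- by move=> x _; rewrite mule_ge0 // lee_fin exponential_pdf_ge0.
- apply: emeasurable_funM => //; apply/measurable_EFinP.
  exact: measurable_exponential_pdf.
- apply/(measurable_restrictT _ _).1 => //; apply/measurable_EFinP.
  apply: measurable_funTS; apply: continuous_measurable_fun.
  exact: continuous_aff_pow.
- move=> x _; rewrite patchE; case: ifPn => [|].
    rewrite inE /= in_itv /= => /andP[x0 xsa].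
    have sx : 0 <= s - a * x by rewrite subr_ge0 mulrC -ler_pdivlMr.
    rewrite -[leRHS]mule1; apply: lee_pmul => //.
    + by rewrite lee_fin exponential_pdf_ge0.
    + by have := PY (s - a * x); rewrite fact_powE // mulrA.
    + rewrite lee_fin exponential_pdfE // mul1r mulN1r -expR0 ler_expR oppr_le0 //.
  rewrite notin_setE /= in_itv /= => /negP; rewrite negb_and -!ltNge => /orP[x0|x0].
    by rewrite lt0_exponential_pdf // mule0.
  by rewrite sect0 //; right.
Qed.

(** For weight 1 the factors [expR (- (s - x))] and [expR (- x)] multiply to the constant
    [expR (- s)], so the form of the bound reproduces itself. *)
Lemma convolution_lower n :
  (forall u, 0 <= u -> ((expR (- u) * fact_pow n u)%:E <= P [set t | (Y t <= u)%R])%E) ->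
  forall s, 0 <= s ->
  ((expR (- s) * fact_pow n.+1 s)%:E <= P [set t | (1 * X t + Y t <= s)%R])%E.
Proof.
move=> PY s s0; have [msec ->] := convolution_le 1 s.
have := integral_aff_pow 1 s (expR (- s)) n ltr01 s0.
rewrite fact_powE // mulrA !divr1 => <-.
rewrite [leLHS]integral_mkcond; apply: ge0_le_integral => //.
- move=> x _; rewrite patchE; case: ifPn => //.
  rewrite inE /= in_itv /= => /andP[x0 xs].
  by rewrite lee_fin mulr_ge0 ?invr_ge0 // mulr_ge0 ?expR_ge0 // exprn_ge0 // mul1r subr_ge0.
- apply/(measurable_restrictT _ _).1 => //; apply/measurable_EFinP.
  apply: measurable_funTS; apply: continuous_measurable_fun.
  exact: continuous_aff_pow.
- apply: emeasurable_funM => //; apply/measurable_EFinP.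
  exact: measurable_exponential_pdf.
- move=> x _; rewrite patchE; case: ifPn => [|_]; last first.
    by rewrite mule_ge0 // lee_fin exponential_pdf_ge0.
  rewrite inE /= in_itv /= => /andP[x0 xs].
  have sx : 0 <= s - 1 * x by rewrite mul1r subr_ge0.
  apply: le_trans (lee_pmul _ _ (PY _ sx) (lexx _)); last 2 first.
  + by rewrite lee_fin mulr_ge0 ?expR_ge0 // fact_powE // divr_ge0 ?exprn_ge0.
  + by rewrite lee_fin exponential_pdf_ge0.
  rewrite -EFinM lee_fin fact_powE // exponential_pdfE // !mul1r !mulN1r.
  have -> : expR (- s) = expR (- (s - x)) * expR (- x).
    by rewrite -expRD; congr expR; ring.
  by rewrite le_eqVlt; apply/orP; left; apply/eqP; ring.
Qed.

End Convolution.

Section WeightedSums.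
Context {d : measure_display} {T : measurableType d} {R : realType}.
Variable P : probability T R.
Variables (I : choiceType) (D : set I) (X : I -> {RV P >-> R}).
Hypothesis X_indep : independent_on D X.
Hypothesis X_exp : forall v, D v -> standard_exponential (X v).

Lemma indep_head a v (g : seq I) A B : uniq (v :: g) -> (forall w, w \in v :: g -> D w) ->
  measurable A -> measurable B ->
  P (X v @^-1` A `&` wsum P I X a g @^-1` B) =
  (P (X v @^-1` A) * P (wsum P I X a g @^-1` B))%E.
Proof.
move=> us Ds mA mB.
have := @wsum_indep_event _ _ _ _ _ _ _ X_indep a g [::] _ (split_indepT _ _ _ _ X_indep a _ _)
  [:: (v, A)] B mB.
rewrite /= !big_nil !big_cons !big_nil !setTI !setIT setIC muleC => -> //.
- by rewrite -cat_rcons cats0 rcons_uniq; move: us.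
- by move=> w; rewrite mem_cat inE orbC => h; apply: Ds; rewrite inE.
- by move=> s; rewrite inE => /eqP ->.
Qed.

Lemma measurable_wsum_le a g s : measurable [set t | wsum P I X a g t <= s].
Proof.
have -> : [set t | wsum P I X a g t <= s] = wsum P I X a g @^-1` `]-oo, s].
  by apply/seteqP; split => t /=; rewrite in_itv.
exact: measurable_wsum_pre.
Qed.

(** The right-hand side is the volume of the simplex of nonnegative labels with weighted sum at most
    [s]; the joint density is at most 1 there. In [sum_le_lower] the density is at least
    [expR (- s)] on the simplex with unit weights. *)
Lemma wsum_le_upper a (g : seq I) : uniq g -> (forall v, v \in g -> D v) ->
  (forall v, v \in g -> 0 < a v) -> forall s,
  (P [set t | (wsum P I X a g t <= s)%R] <=
   (\prod_(v <- g) (a v)^-1 * fact_pow (size g) s)%:E)%E.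
Proof.
elim: g => [|v g IH] us Ds a0 s.
  rewrite big_nil mul1r; have [s0|s0] := leP 0 s.
    by rewrite fact_powE // expr0 divr1 probability_le1 //; exact: measurable_wsum_le.
  rewrite fact_pow_lt0 // (_ : [set t | _] = set0) ?measure0 //.
  by apply/seteqP; split => t //=; rewrite /wsum big_nil leNgt s0.
have av : 0 < a v by apply: a0; rewrite inE eqxx.
have ag w : w \in g -> 0 < a w by move=> wg; apply: a0; rewrite inE wg orbT.
have Dg w : w \in g -> D w by move=> wg; apply: Ds; rewrite inE wg orbT.
have ug : uniq g by case/andP: us.
rewrite (_ : [set t | _] = [set t | a v * X v t + wsum P I X a g t <= s]); last first.
  by apply/seteqP; split => t; rewrite /= wsum_cons.
rewrite big_cons [_^-1 * _]mulrC.
apply: (convolution_upper P (X v)) => //.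
- by apply: X_exp; apply: Ds; rewrite inE eqxx.
- exact: measurable_wsum.
- by move=> A B mA mB; exact: indep_head.
- rewrite big_seq_cond; apply: prodr_ge0 => w; rewrite andbT => wg.
  by rewrite invr_ge0 ltW // ag.
- by move=> u; exact: IH.
Qed.

Lemma sum_le_lower (g : seq I) : uniq g -> (forall v, v \in g -> D v) -> forall s, 0 <= s ->
  ((expR (- s) * fact_pow (size g) s)%:E <=
   P [set t | (wsum P I X (fun=> 1) g t <= s)%R])%E.
Proof.
elim: g => [|v g IH] us Ds s s0.
  rewrite (_ : [set t | _] = setT) ?probability_setT.
    by rewrite fact_powE // expr0 divr1 mulr1 lee_fin expR_le1 oppr_le0.
  by apply/seteqP; split => t //=; rewrite /wsum big_nil s0.
have Dg w : w \in g -> D w by move=> wg; apply: Ds; rewrite inE wg orbT.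
have ug : uniq g by case/andP: us.
rewrite (_ : [set t | _] = [set t | 1 * X v t + wsum P I X (fun=> 1) g t <= s]); last first.
  by apply/seteqP; split => t; rewrite /= wsum_cons.
apply: (convolution_lower P (X v)) => //.
- by apply: X_exp; apply: Ds; rewrite inE eqxx.
- exact: measurable_wsum.
- by move=> A B mA mB; exact: indep_head.
- by move=> u u0; exact: IH.
Qed.

End WeightedSums.

(** * Spherically symmetric families of paths *)

Section UnionBounds.
Context {d : measure_display} {T : measurableType d} {R : realType}.
Variable P : probability T R.

Lemma measure_bigsetU_seq (J : eqType) (s : seq J) (A : J -> set T) :
  (forall p, p \in s -> measurable (A p)) ->
  measurable (\big[setU/set0]_(p <- s) A p) /\
  (P (\big[setU/set0]_(p <- s) A p) <= \sum_(p <- s) P (A p))%E.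
Proof.
elim: s => [|p s IH] mA; first by rewrite !big_nil measure0.
have [mU PU] := IH (fun q qs => mA q (mem_behead (s := p :: s) qs)).
have mp : measurable (A p) by apply: mA; rewrite inE eqxx.
rewrite !big_cons; split; first exact: measurableU.
by apply: le_trans (measureU2 _ _ _) _ => //; exact: leeD2l.
Qed.

Lemma borel_cantelli_geometric (F : (set T)^nat) (r : R) :
  (forall m, measurable (F m)) -> 0 <= r -> r < 1 ->
  (forall m, (P (F m) <= (r ^+ m)%:E)%E) -> P (lim_sup_set F) = 0%E.
Proof.
move=> mF r0 r1 PF; apply: lim_sup_set_cvg0 => //.
apply: le_lt_trans (lee_nneseries _ (fun n _ => PF n)) _ => //.
have cg := @cvg_geometric_series R 1 r.
rewrite (_ : (\sum_(i <oo) _)%E = (1 / (1 - r))%:E) ?ltry //.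
apply/cvg_lim => //.
have -> : (fun n => \sum_(0 <= i < n) (r ^+ i)%:E)%E = EFin \o series (geometric 1 r).
  apply/funext => n; rewrite /= sumEFin /series /= /geometric /=.
  by congr (_%:E); apply: eq_bigr => i _; rewrite mul1r.
by apply: cvg_EFin; [exact: nearW|apply: cg; rewrite ger0_norm].
Qed.

End UnionBounds.

(* A vertex is encoded by the path that leads to it, without the root. By [lev_pth] a vertex
   determines its path, hence two paths share no vertex after they separate. *)
Record spherical_paths (I : choiceType) (D : set I) (f : nat -> nat) := SphericalPaths {
  lev : nat -> seq (seq I) ;
  pth : I -> seq I ;
  lev0 : lev 0 = [:: [::]] ;
  lev_uniq : forall n, uniq (lev n) ;
  lev_size : forall n p, p \in lev n -> size p = n ;
  lev_take : forall n l p, p \in lev n -> (l <= n)%N -> take l p \in lev l ;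
  lev_count : forall n l r, r \in lev l -> (l <= n)%N ->
    (count (fun q => take l q == r) (lev n) * \prod_(1 <= i < l.+1) f i =
     \prod_(1 <= i < n.+1) f i)%N ;
  lev_dom : forall n p v, p \in lev n -> v \in p -> D v ;
  lev_pth : forall n p v0 i, p \in lev n -> (i < n)%N -> pth (nth v0 p i) = take i.+1 p
}.

Arguments lev {I D f}.
Arguments pth {I D f}.
Arguments lev0 {I D f}.
Arguments lev_uniq {I D f}.
Arguments lev_size {I D f}.
Arguments lev_take {I D f}.
Arguments lev_count {I D f}.
Arguments lev_dom {I D f}.
Arguments lev_pth {I D f}.

Section PathFacts.
Context {I : choiceType} {D : set I} {f : nat -> nat}.
Variable G : spherical_paths I D f.

Lemma size_lev (R : realType) n : (size (lev G n))%:R = growth_prod R f n .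
Proof.
have := lev_count G n 0 [::]; rewrite lev0 inE => /(_ erefl isT).
rewrite big_geq // muln1 (_ : count _ _ = size (lev G n)); last first.
  by rewrite -[RHS]count_predT; apply: eq_count => q; rewrite take0.
by move=> ->; rewrite /growth_prod natr_prod.
Qed.

Lemma lev_countR (R : realType) n l r : r \in lev G l -> (l <= n)%N ->
  (count (fun q => take l q == r) (lev G n))%:R * growth_prod R f l = growth_prod R f n .
Proof.
by move=> rl ln; rewrite /growth_prod -!natr_prod -natrM (lev_count G).
Qed.

Lemma uniq_lev_path n p : p \in lev G n -> uniq p.
Proof.
move=> pn; have sp := lev_size G _ _ pn.
case: p pn sp => // v0 p pn sp; apply/(uniqP v0) => i j.
rewrite !inE sp => lin ljn ij.
have := lev_pth G _ _ v0 _ pn lin.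
rewrite ij (lev_pth G _ _ v0 _ pn ljn) => /(congr1 size).
by rewrite !size_takel ?sp // => -[].
Qed.

Lemma lev_disjoint n m p q l v : p \in lev G n -> q \in lev G m ->
  take l.+1 p <> take l.+1 q -> v \in p -> v \notin drop l q.
Proof.
move=> pn qm pq vp; apply/negP => vq; apply: pq.
have sp := lev_size G _ _ pn; have sq := lev_size G _ _ qm.
pose i := index v p; have lin : (i < n)%N by rewrite -sp index_mem.
have [j ljm vj] : exists2 j, (j < m - l)%N & nth v (drop l q) j = v.
  by exists (index v (drop l q)); [rewrite -sq -size_drop index_mem|rewrite nth_index].
rewrite nth_drop in vj.
have ljm' : (l + j < m)%N by rewrite -ltn_subRL.
have := lev_pth G _ _ v _ pn lin; rewrite nth_index // => vE.
have := lev_pth G _ _ v _ qm ljm'; rewrite vj vE => tpq.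
have ij : i = (l + j)%N.
  by move/(congr1 size): (tpq); rewrite !size_takel ?sp ?sq // => -[].
move/(congr1 (take l.+1)): tpq; rewrite !take_takel //.
- by rewrite ltnS leq_addr.
- by rewrite ij ltnS leq_addr.
Qed.

End PathFacts.

(** * The first-moment lower bound *)

Section LowerBound.
Context {d : measure_display} {T : measurableType d} {R : realType}.
Variable P : probability T R.
Variables (I : choiceType) (D : set I) (f : nat -> nat) (G : spherical_paths I D f).
Variable X : I -> {RV P >-> R}.
Hypothesis f_gt0 : forall n, (1 <= n)%N -> (1 <= f n)%N.
Hypothesis X_indep : independent_on D X.
Hypothesis X_exp : forall v, D v -> standard_exponential (X v).

Local Notation phi := (ftilde R f).
Local Notation c_ := (ftilde_prod R f).
Local Notation Z := (growth_prod R f).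

(** The weights of [wsum] are indexed by vertices, so the level is recovered as the length of the
    path to [v]. *)
Definition phi_weight (v : I) : R := phi (size (pth G v)).

Lemma phi_weight_nth n p v0 i : p \in lev G n -> (i < n)%N -> phi_weight (nth v0 p i) = phi i.+1.
Proof.
move=> pn ilt; rewrite /phi_weight (lev_pth G _ _ _ _ pn) // size_takel //.
by rewrite (lev_size G _ _ pn).
Qed.

Lemma phi_weight_gt0 n p v : p \in lev G n -> v \in p -> 0 < phi_weight v.
Proof.
move=> pn vp; rewrite -(nth_index v vp) (phi_weight_nth _ _ _ _ pn) ?ftilde_gt0 //.
by rewrite -(lev_size G _ _ pn) index_mem.
Qed.

Lemma prod_phi_weight n p : p \in lev G n -> \prod_(v <- p) (phi_weight v)^-1 = (c_ n)^-1.
Proof.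
move=> pn; rewrite ftilde_prodE.
have sp := lev_size G _ _ pn.
case: p pn sp => [|v0 p] pn sp; first by rewrite -sp big_nil big_geq ?invr1.
rewrite (big_nth v0) sp prodfV; congr (_^-1).
rewrite big_add1 /=; apply: eq_big_nat => i /andP[_ ilt].
exact: phi_weight_nth pn _.
Qed.

Lemma weighted_path_le n p (s : R) : p \in lev G n -> 0 <= s ->
  (P [set t | (wsum P I X phi_weight p t <= s)%R] <= (s ^+ n / n`!%:R / c_ n)%:E)%E.
Proof.
move=> pn s0.
have := wsum_le_upper P I D X X_indep X_exp phi_weight p (uniq_lev_path G _ _ pn).
move=> /(_ (fun v => lev_dom G _ _ v pn) (fun v => phi_weight_gt0 _ _ v pn) s).
by rewrite (prod_phi_weight n) // fact_powE // (lev_size G _ _ pn) mulrC.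
Qed.

(* The levels at which the union bound is effective: infinitely many, and all those after which
   [ftilde] jumps. *)
Definition tight_level (e : R) (m : nat) : bool := Z m <= c_ m * (1 + e) ^+ m.

(** The event is empty at the remaining levels, so that one geometric bound holds for all [m] and
    Borel-Cantelli applies to the full sequence. *)
Definition slow_event (e c : R) (m : nat) : set T :=
  if tight_level e m
  then \big[setU/set0]_(p <- lev G m) [set t | wsum P I X phi_weight p t <= c * m%:R]
  else set0.

Lemma measurable_slow_event e c m : measurable (slow_event e c m).
Proof.
rewrite /slow_event; case: ifP => // _.
apply: (proj1 (measure_bigsetU_seq P _ _ _ _)) => p _; exact: measurable_wsum_le.
Qed.

(** Tightness bounds the number of paths by [c_ m * (1 + e) ^+ m], and [c_ m] cancels against the
    product of the weights; the factor [expR 1] is the price of [m ^ m / m!]. *)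
Lemma slow_event_le e c m : 0 <= e -> 0 <= c ->
  (P (slow_event e c m) <= (((1 + e) * c * expR 1) ^+ m)%:E)%E.
Proof.
move=> e0 c0; rewrite /slow_event; case: ifPn => [tm|_]; last first.
  by rewrite measure0 lee_fin exprn_ge0 // mulr_ge0 ?expR_ge0 // mulr_ge0 // addr_ge0.
have cm0 : 0 <= c * m%:R by rewrite mulr_ge0.
apply: le_trans (proj2 (measure_bigsetU_seq P _ _ _ _)) _ => [p _|].
  exact: measurable_wsum_le.
apply: (@le_trans _ _ (\sum_(p <- lev G m) ((c * m%:R) ^+ m / m`!%:R / c_ m)%:E)%E).
  by rewrite big_seq [leRHS]big_seq; apply: lee_sum => p pm; exact: weighted_path_le.
rewrite sumEFin lee_fin big_const_seq count_predT iter_addr_0 -[leLHS]mulr_natl size_lev.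
have cg := ftilde_prod_gt0 (R := R) f_gt0 m.
have mf : 0 < (m`!%:R : R) by rewrite ltr0n fact_gt0.
apply: (@le_trans _ _ (c_ m * (1 + e) ^+ m * ((c * m%:R) ^+ m / m`!%:R / c_ m))).
  rewrite ler_wpM2r //.
  by apply: divr_ge0; [apply: divr_ge0; [exact: exprn_ge0|exact: ler0n]|exact: (ltW cg)].
rewrite [leLHS](_ : _ = ((1 + e) * c) ^+ m * (m%:R ^+ m / m`!%:R)); last first.
  rewrite !exprMn; move: ((1 + e) ^+ m) (c ^+ m) (m%:R ^+ m) => x y z.
  by field; rewrite !gt_eqF.
rewrite [leRHS]exprMn ler_wpM2l ?exprn_ge0 ?mulr_ge0 ?addr_ge0 //.
by rewrite ler_pdivrMr // exprnn_le_fact.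
Qed.

Lemma wsum_phi_take n p v0 m t : p \in lev G n -> (m <= n)%N ->
  wsum P I X phi_weight (take m p) t =
  \sum_(0 <= i < m) phi i.+1 * X (nth v0 p i) t.
Proof.
move=> pn mn; have sp := lev_size G _ _ pn.
rewrite /wsum (big_nth v0) size_takel ?sp //.
apply: eq_big_nat => i /andP[_ im].
by rewrite nth_take // (phi_weight_nth n) // (leq_trans im).
Qed.

Lemma sum_lower_bound e c m0 n p t : 0 <= e -> 0 <= c ->
  (forall p v, p \in lev G n -> v \in p -> 0 <= X v t) ->
  (forall m, (m0 <= m)%N -> ~ slow_event e c m t) ->
  (m0 <= n)%N -> tight_level e n -> p \in lev G n ->
  c * (\sum_(1 <= i < n.+1) (phi i)^-1) - c * m0%:R <= \sum_(v <- p) X v t.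
Proof.
move=> e0 c0 X0 noslow m0n tn pn.
have fastT m q : tight_level e m -> (m0 <= m)%N -> q \in lev G m ->
    c * m%:R <= wsum P I X phi_weight q t.
  move=> tm m0m qm; rewrite leNgt; apply/negP => lt; apply: (noslow m m0m).
  by rewrite /slow_event tm -bigcup_seq; exists q => //=; exact: ltW.
have sp := lev_size G _ _ pn.
case: p pn sp => [|v0 p'] pn sp.
  rewrite -sp [leRHS]big_nil big_geq // mulr0 sub0r oppr_le0 mulr_ge0 //.
set p := v0 :: p' in pn sp *.
case: n X0 m0n tn pn sp => // n X0 m0n tn pn sp.
pose b i := (phi i.+1)^-1; pose x i := X (nth v0 p i) t.
(* With [b] the inverse weights, the sum of [b i * u i] is the passage time minus [c] times the sum
   of the inverses of [ftilde]. *)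
pose u i := phi i.+1 * x i - c.
have b0 i : 0 <= b i by rewrite invr_ge0 ltW // ftilde_gt0.
have U j : (j <= n.+1)%N -> (tight_level e j) -> - (c * m0%:R) <= \sum_(0 <= i < j) u i.
  move=> jn tj; rewrite /u sumrB sumr_const_nat subn0 -(wsum_phi_take n.+1) //.
  have qj := lev_take G _ _ _ pn jn.
  have [m0j|jm0] := leqP m0 j.
    apply: (@le_trans _ _ 0); first by rewrite oppr_le0 mulr_ge0.
    by rewrite subr_ge0 -mulr_natr fastT.
  (* Below [m0] nothing is known about the slow events; nonnegative labels alone give [- c * j],
     whence the error [c * m0]. *)
  apply: (@le_trans _ _ (- (c * j%:R))).
    by rewrite lerN2 ler_wpM2l // ler_nat ltnW.
  rewrite mulr_natr lerDr /wsum big_seq; apply: sumr_ge0 => v vq.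
  rewrite mulr_ge0 //; first by rewrite ltW // (phi_weight_gt0 _ _ _ qj).
  by apply: (X0 p) => //; exact: mem_take vq.
have := abel_lower_bound b u (c * m0%:R) n (mulr_ge0 c0 (ler0n _ _)) b0.
have bS i : b i.+1 <= b i.
  by rewrite /b lef_pV2 ?posrE ?ftilde_gt0 // ftilde_leS.
move=> /(_ bS) H.
have {}H : - (c * m0%:R * b 0) <= \sum_(0 <= i < n.+1) b i * u i.
  apply: H => [j jn|]; last exact: U.
  rewrite /b ltf_pV2 ?posrE ?ftilde_gt0 // => jump.
  apply: U; first exact: ltnW.
  rewrite /tight_level (ftilde_jump f_gt0 _ _ jump) // ler_peMr //.
    by rewrite ltW // ftilde_prod_gt0.
  by rewrite exprn_ege1 // lerDl.
have bu : \sum_(0 <= i < n.+1) b i * u i =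
    \sum_(v <- p) X v t - c * \sum_(1 <= i < n.+2) (phi i)^-1.
  rewrite (big_nth v0) sp big_add1 /= mulr_sumr -sumrB.
  apply: eq_big_nat => i _; rewrite /u mulrBr mulrA /b mulVf ?mul1r ?[c * _]mulrC //.
  by rewrite gt_eqF // ftilde_gt0.
have b1 : b 0%N <= 1 by rewrite /b invf_le1 ?ftilde_gt0 // ftilde_ge1.
rewrite -lerBrDl -bu in H *.
apply: le_trans H; rewrite lerN2 ler_piMr // mulr_ge0 //.
Qed.

Lemma exp_ge0 v : D v -> P [set t | X v t < 0] = 0%E.
Proof.
move=> Dv; have := X_exp v Dv `]-oo, 0[%classic (measurable_itv _).
rewrite /distribution /pushforward (_ : _ @^-1` _ = [set t | X v t < 0]) => [->|]; last first.
  by apply/seteqP; split => t /=; rewrite in_itv.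
rewrite /exponential_prob integral0_eq // => x /=; rewrite in_itv /= => x0.
by rewrite lt0_exponential_pdf.
Qed.

Lemma ae_labels_ge0 :
  {ae P, forall t n p v, p \in lev G n -> v \in p -> 0 <= X v t}.
Proof.
have mlt v : measurable [set t | X v t < 0].
  rewrite (_ : [set t | _] = X v @^-1` `]-oo, 0[); last first.
    by apply/seteqP; split => t /=; rewrite in_itv.
  exact: measurable_funPTI.
pose A n := \big[setU/set0]_(p <- lev G n) \big[setU/set0]_(v <- p) [set t | X v t < 0].
have negA n : P.-negligible (A n).
  have mp p : measurable (\big[setU/set0]_(v <- p) [set t | X v t < 0]).
    by apply: (proj1 (measure_bigsetU_seq P _ _ _ _)).
  have [mA PA] := measure_bigsetU_seq P _ (lev G n) _ (fun p _ => mp p).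
  apply/negligibleP => //; apply/eqP; rewrite eq_le measure_ge0 andbT.
  apply: le_trans PA _; rewrite big_seq big1 // => p pn.
  apply/eqP; rewrite eq_le measure_ge0 andbT.
  apply: le_trans (proj2 (measure_bigsetU_seq P _ _ _ _)) _ => //.
  by rewrite big_seq big1 // => v vp; apply: exp_ge0; exact: lev_dom pn vp.
apply: negligibleS (negligible_bigcup negA) => t /= /existsNP[n /existsNP[p /existsNP[v]]].
move=> /not_implyP[pn /not_implyP[vp /negP]]; rewrite -ltNge => xv.
exists n => //; rewrite /A -bigcup_seq; exists p => //.
by rewrite -bigcup_seq; exists v.
Qed.

Lemma ae_lower_bound (c : R) : 0 <= c -> c < expR (-1) ->
  {ae P, forall t, exists B : R, forall N, exists2 n, (N <= n)%N &
    forall p, p \in lev G n ->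
      c * (\sum_(1 <= i < n.+1) (phi i)^-1) - B <= \sum_(v <- p) X v t}.
Proof.
move=> c0 ce; pose k := c * expR 1.
have k0 : 0 <= k by rewrite mulr_ge0 ?expR_ge0.
have k1 : k < 1 by rewrite -ltr_pdivlMr ?expR_gt0 // mul1r -expRN.
(* The ratio [(1 + e) * k] stays below 1, since [1 - (1 + e) * k = (1 - k) * (1 - k / 2)]. *)
pose e := (1 - k) / 2; have e0 : 0 < e by rewrite divr_gt0 // subr_gt0.
have r1 : (1 + e) * c * expR 1 < 1.
  by rewrite -mulrA -/k /e; nra.
have r0 : 0 <= (1 + e) * c * expR 1 by rewrite -mulrA mulr_ge0 // addr_ge0 // ltW.
have BC := borel_cantelli_geometric P (slow_event e c) _ (measurable_slow_event e c) r0 r1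
  (fun m => slow_event_le _ _ m (ltW e0) c0).
have nBC : P.-negligible (lim_sup_set (slow_event e c)).
  apply/negligibleP => //; apply: bigcap_measurable => // n _.
  by apply: bigcup_measurable => j _; exact: measurable_slow_event.
have := negligibleU nBC ae_labels_ge0; apply: negligibleS => t /= H.
apply: contrapT => /not_orP[nlim /contrapT X0]; apply: H.
have [m0 noslow] : exists m0, forall m, (m0 <= m)%N -> ~ slow_event e c m t.
  move: nlim => /existsNP[m0 /not_implyP[_ h]]; exists m0 => m m0m hm; apply: h.
  by exists m.
exists (c * m0%:R) => N.
have [n nN tn] := growth_prod_close_io (R := R) f_gt0 e (maxn N m0) e0.
exists n; first by rewrite (leq_trans _ nN) // leq_maxl.
move=> p pn; apply: (sum_lower_bound e c m0 n p t (ltW e0)) => //.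
- by move=> q v; exact: X0.
- by rewrite (leq_trans _ nN) // leq_maxr.
Qed.

End LowerBound.

(** * The second-moment upper bound *)

Section SecondMoment.
Context {d : measure_display} {T : measurableType d} {R : realType}.
Variable P : probability T R.

Definition prob (A : set T) : R := fine (P A).

Lemma probE A : measurable A -> P A = (prob A)%:E.
Proof. by move=> mA; rewrite /prob fineK // fin_num_measure. Qed.

Lemma prob_ge0 A : 0 <= prob A.
Proof. by rewrite /prob fine_ge0. Qed.

Lemma prob_le A B : measurable A -> measurable B -> A `<=` B -> prob A <= prob B.
Proof.
move=> mA mB AB; rewrite -lee_fin -!probE //; apply: le_measure => //; by rewrite inE.
Qed.

Lemma integral_indic_comb (s : seq (R * set T)) :
  (forall kB, kB \in s -> measurable kB.2) ->
  P.-integrable setT (fun t => (\sum_(kB <- s) kB.1 * \1_(kB.2) t)%:E) /\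
  (\int[P]_t (\sum_(kB <- s) kB.1 * \1_(kB.2) t)%R%:E =
   (\sum_(kB <- s) kB.1 * prob kB.2)%R%:E)%E.
Proof.
elim: s => [|[k B] s IH] ms.
  split; first by under eq_fun do rewrite big_nil; exact: integrable0.
  by under eq_integral do rewrite big_nil; rewrite integral0 big_nil.
have [is_ iE] := IH (fun kB kBs => ms kB (mem_behead (s := _ :: s) kBs)).
have mB : measurable B by apply: (ms (k, B)); rewrite inE eqxx.
have iB := integrable_indic P mB.
have iZ : P.-integrable setT (fun t => k%:E * (\1_B t)%:E)%E by exact: integrableZl.
have E t : (\sum_(kB <- (k, B) :: s) kB.1 * \1_(kB.2) t)%:E =
  (k%:E * (\1_B t)%:E + (\sum_(kB <- s) kB.1 * \1_(kB.2) t)%R%:E)%E.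
  by rewrite big_cons EFinD EFinM.
split; first by under eq_fun do rewrite E; exact: integrableD.
under eq_integral do rewrite E.
rewrite integralD // iE integralZl // integral_indic // setIT big_cons EFinD EFinM.
by congr (_ * _ + _)%E; exact: probE.
Qed.

(** Pointwise inequalities between finite combinations of indicators pass to probabilities, which
    makes the second moment bound a matter of algebra. *)
Lemma indic_comb_ge0 (s : seq (R * set T)) :
  (forall kB, kB \in s -> measurable kB.2) ->
  (forall t, 0 <= \sum_(kB <- s) kB.1 * \1_(kB.2) t) ->
  0 <= \sum_(kB <- s) kB.1 * prob kB.2.
Proof.
move=> ms s0; have [_ iE] := integral_indic_comb _ ms.
by rewrite -lee_fin -iE; apply: integral_ge0 => t _; rewrite lee_fin.
Qed.

(* Chebyshev's inequality for the sum of the [w p * \1_(A p)], of mean [size s]. *)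
Lemma second_moment (J : choiceType) (s : seq J) (A : J -> set T) (w : J -> R) :
  (forall p, p \in s -> measurable (A p)) ->
  (forall p, p \in s -> w p * prob (A p) = 1) ->
  (size s)%:R ^+ 2 * prob (~` \big[setU/set0]_(p <- s) A p) <=
  \sum_(p <- s) \sum_(q <- s) (w p * w q * prob (A p `&` A q) - 1).
Proof.
move=> mA wA; set N : R := (size s)%:R; set none := ~` _.
have mnone : measurable none.
  by apply: measurableC; exact: (proj1 (measure_bigsetU_seq P _ _ _ mA)).
(* The combination expands [(W - N) ^ 2 - N ^ 2 * 1_none], where [W] is the weighted sum of the
   indicators. It is nonnegative because [W = 0] on [none]. *)
pose s2 := [seq (w p * w q, A p `&` A q) | p <- s, q <- s].
pose s1 := [seq (- (2 * N * w p), A p) | p <- s].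
have ms kB : kB \in s2 ++ s1 ++ [:: (N ^+ 2, setT); (- N ^+ 2, none)] -> measurable kB.2.
  rewrite !mem_cat !inE => /or3P[/allpairsP[[p q] [ps qs ->]]|/mapP[p ps ->]|/orP[/eqP->|/eqP->]]
    //.
  - by apply: measurableI; exact: mA.
  - exact: mA.
  - exact: measurableT.
have sumE (F : set T -> R) : \sum_(kB <- s2 ++ s1 ++ [:: (N ^+ 2, setT);
  (- N ^+ 2, none)]) kB.1 * F kB.2
   = \sum_(p <- s) \sum_(q <- s) (w p * w q * F (A p `&` A q)) - 2 * N * (\sum_(p <- s) w p * F
     (A p))
     + N ^+ 2 * F setT - N ^+ 2 * F none.
  rewrite !big_cat /= big_allpairs_dep big_map !big_cons big_nil addr0 mulr_sumr -sumrN.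
  rewrite !addrA mulNr; congr (_ + _ + _ - _); apply: eq_bigr => p _ /=; ring.
have := indic_comb_ge0 _ ms.
rewrite (sumE prob).
have -> : prob setT = 1 by rewrite /prob probability_setT.
rewrite (_ : \sum_(p <- s) w p * prob (A p) = N); last first.
  by rewrite (eq_big_seq (fun=> 1)) // big_const_seq count_predT iter_addr_0.
rewrite mulr1 => H.
have {}H : 0 <= \sum_(p <- s) \sum_(q <- s) w p * w q * prob (A p `&` A q)
    - 2 * N * N + N ^+ 2 - N ^+ 2 * prob none.
  apply: H => t; rewrite (sumE (fun B => \1_B t)) indicT mulr1.
  set W := \sum_(p <- s) w p * \1_(A p) t.
  have -> : \sum_(p <- s) \sum_(q <- s) w p * w q * \1_(A p `&` A q) t = W ^+ 2.
    rewrite expr2 /W big_distrlr /=; apply: eq_bigr => p _; apply: eq_bigr => q _.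
    by rewrite indicI /=; ring.
  rewrite indicE; case: (boolP (t \in none)) => tn; last first.
    by rewrite mulr0 subr0 (_ : _ + _ = (W - N) ^+ 2) ?sqr_ge0 //; ring.
  suff -> : W = 0 by rewrite /= expr0n mulr0 mulr1 subr0 add0r subrr.
  rewrite /W big_seq big1 // => p ps; rewrite indicE memNset ?mulr0 // => Ap.
  have := set_mem tn; rewrite /none -bigcup_seq; apply; by exists p.
have -> : \sum_(p <- s) \sum_(q <- s) (w p * w q * prob (A p `&` A q) - 1) =
    \sum_(p <- s) \sum_(q <- s) w p * w q * prob (A p `&` A q) - N ^+ 2.
  under eq_bigr do rewrite sumrB.
  rewrite sumrB; congr (_ - _).
  by rewrite !big_const_seq !count_predT !iter_addr_0 -/N -mulr_natr expr2.
lra.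
Qed.

End SecondMoment.

(** * Paths cut into blocks, and the joint probability for two paths *)

Section Blocks.
Context {I : eqType}.

Definition block (k : nat) (s : seq I) (i : nat) : seq I := take k (drop (i * k) s).

Lemma flatten_block k s a m :
  flatten [seq block k s i | i <- iota a m] = take (m * k) (drop (a * k) s).
Proof.
elim: m a => [|m IH] a /=; first by rewrite take0.
by rewrite IH /block [(m.+1 * k)%N]mulSn takeD drop_drop -mulSn.
Qed.

Lemma size_block k s i J : size s = (J * k)%N -> (i < J)%N -> size (block k s i) = k.
Proof.
move=> ss iJ; rewrite /block size_takel // size_drop ss -mulnBl leq_pmull //.
by rewrite subn_gt0.
Qed.

Lemma mem_block k s i v : v \in block k s i -> v \in s.
Proof. by move=> vb; exact: mem_drop (mem_take vb). Qed.

Lemma uniq_block k s i : uniq s -> uniq (block k s i).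
Proof. by move=> us; apply: take_uniq; exact: drop_uniq. Qed.

End Blocks.

Section BlockEvents.
Context {d : measure_display} {T : measurableType d} {R : realType}.
Variable P : probability T R.
Variables (I : choiceType) (D : set I) (X : I -> {RV P >-> R}).
Hypothesis X_indep : independent_on D X.
Hypothesis X_exp : forall v, D v -> standard_exponential (X v).
Variables (k : nat) (b : nat -> R).
Hypothesis b_ge0 : forall i, 0 < b i.
Hypothesis b_small : forall i, 2^-1 <= expR (- b i).

Definition sum_le_event (g : seq I) (u : R) : set T := [set t | wsum P I X (fun=> 1) g t <= u].

Lemma measurable_sum_le_event g u : measurable (sum_le_event g u).
Proof. exact: measurable_wsum_le. Qed.

#[local] Hint Resolve measurable_sum_le_event : core.

Lemma measurable_sum_le_event_cap (gs : seq (seq I * R)) :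
  measurable (\big[setI/setT]_(g <- gs) sum_le_event g.1 g.2).
Proof.
elim: gs => [|g gs IH]; first by rewrite big_nil.
by rewrite big_cons; apply: measurableI => //; exact: measurable_sum_le_event.
Qed.

Lemma prob_sum_le_event_cap (gs : seq (seq I * R)) :
  uniq (flatten (unzip1 gs)) -> (forall v, v \in flatten (unzip1 gs) -> D v) ->
  prob P (\big[setI/setT]_(g <- gs) sum_le_event g.1 g.2) = \prod_(g <- gs) prob P (sum_le_event
    g.1 g.2).
Proof.
move=> us Ds.
pose hs := [seq (g.1, `]-oo, g.2]%classic) | g <- gs].
have lewE g u : sum_le_event g u = wsum P I X (fun=> 1) g @^-1` `]-oo, u].
  by apply/seteqP; split => t; rewrite /sum_le_event /= in_itv.
have hs1 : unzip1 hs = unzip1 gs by rewrite /unzip1 -map_comp.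
have mh g : g \in hs -> measurable g.2.
  by move=> /mapP[h' _ ->]; exact: measurable_itv.
have h : P (\big[setI/setT]_(g <- gs) sum_le_event g.1 g.2) = (\prod_(g <- gs) prob P
  (sum_le_event g.1 g.2))%:E.
  rewrite (eq_bigr (fun g => wsum P I X (fun=> 1) g.1 @^-1` `]-oo, g.2])); last by move=> g _;
    exact: lewE.
  have := group_indep P I D X X_indep (fun=> 1) hs; rewrite hs1 => /(_ us Ds mh).
  rewrite !big_map => -> /=; rewrite -prodEFin; apply: eq_bigr => g _.
  by rewrite -(lewE g.1 g.2) probE //; exact: measurable_sum_le_event.
by rewrite {1}/prob h.
Qed.

Lemma prob_le_ae (A B : set T) : measurable A -> measurable B ->
  {ae P, forall t, A t -> B t} -> prob P A <= prob P B.
Proof.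
move=> mA mB [N [mN PN AB]].
have : prob P A <= prob P (B `|` N).
  apply: prob_le => //; first exact: measurableU.
  move=> t At; have [Bt|nBt] := pselect (B t); [by left|right].
  by apply: AB => /= h; exact: nBt (h At).
move=> /le_trans; apply; rewrite -lee_fin -!probE //; last exact: measurableU.
apply: (le_trans (measureU2 P mB mN)).
by rewrite [X in (_ + X)%E](PN : P N = 0%E) adde0.
Qed.

Definition good (J : nat) (s : seq I) : set T :=
  \big[setI/setT]_(i <- iota 0 J) sum_le_event (block k s i) (b i).

Definition block_prob (s : seq I) (i : nat) : R := prob P (sum_le_event (block k s i) (b i)).

Lemma goodE J s : good J s =
  \big[setI/setT]_(g <- [seq (block k s i, b i) | i <- iota 0 J]) sum_le_event g.1 g.2.
Proof. by rewrite big_map. Qed.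

Lemma measurable_good J s : measurable (good J s).
Proof. by rewrite goodE; exact: measurable_sum_le_event_cap. Qed.

Lemma unzip1_block (s : seq I) a m : unzip1 [seq (block k s i, b i) | i <- iota a m] = [seq block
  k s i | i <- iota a m].
Proof. by rewrite /unzip1 -map_comp. Qed.

Lemma prob_good J s : size s = (J * k)%N -> uniq s -> (forall v, v \in s -> D v) ->
  prob P (good J s) = \prod_(i <- iota 0 J) block_prob s i.
Proof.
move=> ss us Ds; have fl : flatten (unzip1 [seq (block k s i, b i) | i <- iota 0 J]) = s.
  by rewrite unzip1_block flatten_block mul0n drop0 -ss take_size.
by rewrite goodE prob_sum_le_event_cap ?fl // big_map.
Qed.

(** The simplex volume times 1/2, the lower bound for [expR (- b i)] in [b_small]. *)
Definition block_lb (i : nat) : R := b i ^+ k / k`!%:R / 2.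

Lemma block_lb_gt0 i : 0 < block_lb i.
Proof. by rewrite !divr_gt0 ?exprn_gt0 // ltr0n fact_gt0. Qed.

Lemma block_prob_ge J s i : size s = (J * k)%N -> uniq s -> (forall v, v \in s -> D v) ->
  (i < J)%N -> block_lb i <= block_prob s i.
Proof.
move=> ss us Ds iJ.
have : expR (- b i) * fact_pow (size (block k s i)) (b i) <= block_prob s i.
  rewrite -lee_fin -(probE P) //.
  apply: (sum_le_lower P I D X X_indep X_exp) => //; first exact: uniq_block.
    by move=> v vb; apply: Ds; exact: mem_block vb.
  exact: ltW.
move=> h; apply: le_trans h.
rewrite (size_block _ _ _ J) // fact_powE ?(ltW (b_ge0 i)) // /block_lb mulrC.
by rewrite ler_wpM2r // divr_ge0 // exprn_ge0 // ltW.
Qed.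

Lemma prob_sum_le_event1_le v u : D v -> 0 <= u -> prob P (sum_le_event [:: v] u) <= u.
Proof.
move=> Dv u0.
rewrite -lee_fin -(probE P) //.
have := wsum_le_upper P I D X X_indep X_exp (fun=> 1) [:: v] isT.
rewrite big_seq1 invr1 => /(_ _ _ u); rewrite mul1r fact_powE //= expr1 divr1.
by apply => // w; rewrite inE => /eqP ->.
Qed.

Lemma good_pair_disjoint J s s' : size s = (J * k)%N -> size s' = (J * k)%N ->
  uniq (s ++ s') -> (forall v, v \in s ++ s' -> D v) ->
  prob P (good J s `&` good J s') = prob P (good J s) * prob P (good J s').
Proof.
move=> ss ss' us Ds.
pose g1 := [seq (block k s i, b i) | i <- iota 0 J].
pose g2 := [seq (block k s' i, b i) | i <- iota 0 J].
have fl : flatten (unzip1 (g1 ++ g2)) = s ++ s'.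
  rewrite /unzip1 map_cat flatten_cat -!/(unzip1 _) !unzip1_block !flatten_block.
  by rewrite mul0n !drop0 -{1}ss -ss' !take_size.
have us1 : uniq s by move: us; rewrite cat_uniq => /and3P[].
have us2 : uniq s' by move: us; rewrite cat_uniq => /and3P[].
have := prob_sum_le_event_cap (g1 ++ g2); rewrite fl => /(_ us Ds).
rewrite !big_cat !big_map /= => ->; rewrite !prob_good //.
- by move=> v vs; apply: Ds; rewrite mem_cat vs orbT.
- by move=> v vs; apply: Ds; rewrite mem_cat vs.
Qed.

(* In the block [j] where the two paths separate, each single passage time is bounded by [b j];
   the loss is a factor that depends only on [k]. *)
Lemma good_pair_shared J s s' j l : size s = (J * k)%N -> size s' = (J * k)%N ->
  uniq s -> uniq s' -> (forall v, v \in s ++ s' -> D v) ->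
  {ae P, forall t v, v \in s ++ s' -> 0 <= X v t} ->
  (j < J)%N -> (l < k)%N ->
  (forall v, v \in s -> v \notin drop (j * k + l.+1) s') ->
  prob P (good J s `&` good J s') <=
  \prod_(i <- iota 0 j) block_prob s i * b j ^+ (k + (k - l.+1)) *
  (\prod_(i <- iota j.+1 (J - j.+1)) block_prob s i *
   \prod_(i <- iota j.+1 (J - j.+1)) block_prob s' i).
Proof.
move=> ss ss' us us' Ds X0 jJ lk disj.
pose gb (s : seq I) i0 m := [seq (block k s i, b i) | i <- iota i0 m].
pose sing (g : seq I) : seq (seq I * R) := [seq ([:: v], b j) | v <- g].
pose C := drop l.+1 (block k s' j).
(* The constraints on [s'] up to its separation from [s] are dropped. What remains concerns disjoint
   sets of vertices, hence independent groups; the singletons number [k] from [s] and [k - l.+1]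
   from [s']. *)
pose gs := gb s 0%N j ++ sing (block k s j) ++ sing C ++
  gb s j.+1 (J - j.+1)%N ++ gb s' j.+1 (J - j.+1)%N.
have flsing g : flatten (unzip1 (sing g)) = g.
  by rewrite /sing /unzip1 -map_comp /=; elim: g => //= v g ->.
have flend (s0 : seq I) : size s0 = (J * k)%N ->
    flatten (unzip1 (gb s0 j.+1 (J - j.+1)%N)) = drop (j.+1 * k) s0.
  move=> ss0; rewrite unzip1_block flatten_block take_oversize // size_drop ss0.
  by rewrite mulnBl.
have flE : flatten (unzip1 gs) = take (j * k) s ++ block k s j ++ C ++
    drop (j.+1 * k) s ++ drop (j.+1 * k) s'.
  rewrite /unzip1 !map_cat !flatten_cat -!/(unzip1 _) !flsing !flend //.
  by rewrite unzip1_block flatten_block mul0n drop0.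
have sE : s = take (j * k) s ++ block k s j ++ drop (j.+1 * k) s.
  by rewrite -{1}(cat_take_drop (j * k) s) /block -{1}(cat_take_drop k (drop (j * k) s))
    drop_drop mulSn.
have s'E : drop (j * k + l.+1) s' = C ++ drop (j.+1 * k) s'.
  rewrite /C /block addnC -drop_drop -{1}(cat_take_drop k (drop (j * k) s')) drop_drop -mulSn.
  have sz : size (take k (drop (j * k) s')) = k := size_block k s' j J ss' jJ.
  rewrite drop_cat sz; move: lk; rewrite leq_eqVlt => /predU1P[lk|->//].
  by rewrite lk ltnn subnn drop0 [X in _ = X ++ _]drop_oversize // sz.
have pm : perm_eq (flatten (unzip1 gs)) (s ++ drop (j * k + l.+1) s').
  rewrite flE s'E [in X in perm_eq _ X]sE -!catA !perm_cat2l.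
  by rewrite perm_catCA.
have ugs : uniq (flatten (unzip1 gs)).
  rewrite (perm_uniq pm) cat_uniq us drop_uniq // andbT /=.
  by apply/hasPn => v vd; apply/negP => vs; have := disj v vs; rewrite vd.
have Dgs v : v \in flatten (unzip1 gs) -> D v.
  rewrite (perm_mem pm) mem_cat => /orP[vs|/mem_drop vs]; apply: Ds; rewrite mem_cat vs ?orbT //.
have b0 := ltW (b_ge0 j).
have bound g : (forall v, v \in g -> D v) ->
    \prod_(v <- g) prob P (sum_le_event [:: v] (b j)) <= b j ^+ size g.
  elim: g => [|v g IH] Dg; first by rewrite big_nil.
  rewrite big_cons exprS ler_pM ?prob_ge0 //.
  - by apply: prodr_ge0 => h _; exact: prob_ge0.
  - by apply: prob_sum_le_event1_le => //; apply: Dg; rewrite inE eqxx.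
  - by apply: IH => w wg; apply: Dg; rewrite inE wg orbT.
apply: (@le_trans _ _ (prob P (\big[setI/setT]_(g <- gs) sum_le_event g.1 g.2))).
  apply: prob_le_ae; [by apply: measurableI;
    exact: measurable_good|exact: measurable_sum_le_event_cap|].
  apply: filterS X0 => t X0 [gt gt'].
  have goodP s0 i : good J s0 t -> (i < J)%N -> sum_le_event (block k s0 i) (b i) t.
    rewrite /good -bigcap_seq => h iJ; apply: h => /=.
    by rewrite mem_iota.
  have singP s0 v : good J s0 t -> (forall w, w \in s0 -> 0 <= X w t) ->
      v \in block k s0 j -> sum_le_event [:: v] (b j) t.
    move=> g0 X00 vb; have := goodP s0 j g0 jJ; rewrite /sum_le_event /= /wsum big_seq1.
    apply: le_trans; rewrite (big_rem v) //= lerDl big_seq.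
    apply: sumr_ge0 => w wb; rewrite mul1r X00 //.
    exact: mem_block (mem_rem wb).
  rewrite -bigcap_seq => h /=; rewrite !mem_cat.
  case/orP => [/mapP[i]|]; first by rewrite mem_iota add0n => /andP[_ ij] ->; apply: goodP => //;
    exact: ltn_trans jJ.
  case/orP => [/mapP[v vb ->]|].
    by apply: (singP s) => // w ws; apply: X0; rewrite mem_cat ws.
  case/orP => [/mapP[v vb ->]|].
    apply: (singP s') => //; last exact: mem_drop vb.
    by move=> w ws; apply: X0; rewrite mem_cat ws orbT.
  by case/orP => /mapP[i]; rewrite mem_iota subnKC // => /andP[_ ij] ->; exact: goodP.
rewrite prob_sum_le_event_cap // /gs !big_cat /= !big_map /= -!/(block_prob _ _).
rewrite -mulrA ler_wpM2l ?prodr_ge0 // => [i _|]; first exact: prob_ge0.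
rewrite mulrA exprD ler_wpM2r //.
  by rewrite mulr_ge0 // prodr_ge0 // => i _; exact: prob_ge0.
have sb := size_block k s j J ss jJ.
have sC : size C = (k - l.+1)%N by rewrite size_drop (size_block k s' j J).
rewrite -[in b j ^+ k]sb -sC ler_pM ?bound //.
- by apply: prodr_ge0 => v _; exact: prob_ge0.
- by apply: prodr_ge0 => v _; exact: prob_ge0.
- by move=> v /mem_block vs; apply: Ds; rewrite mem_cat vs.
- by move=> v /mem_drop /mem_block vs; apply: Ds; rewrite mem_cat vs orbT.
Qed.

Lemma good_prob_gt0 J s : size s = (J * k)%N -> uniq s -> (forall v, v \in s -> D v) ->
  0 < prob P (good J s).
Proof.
move=> ss us Ds; rewrite prob_good // big_seq; apply: prodr_gt0 => i.
rewrite mem_iota => /andP[_ iJ]; apply: lt_le_trans (block_lb_gt0 i) _.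
exact: (block_prob_ge J).
Qed.

(** The blocks after [j] of both paths and the blocks before [j] of [s] cancel. Left in the
    denominator are block [j] of both and the earlier blocks of [s'], all bounded below by
    [block_lb]. *)
Lemma good_pair_ratio J s s' j l : size s = (J * k)%N -> size s' = (J * k)%N ->
  uniq s -> uniq s' -> (forall v, v \in s ++ s' -> D v) ->
  {ae P, forall t v, v \in s ++ s' -> 0 <= X v t} ->
  (j < J)%N -> (l < k)%N ->
  (forall v, v \in s -> v \notin drop (j * k + l.+1) s') ->
  (prob P (good J s))^-1 * (prob P (good J s'))^-1 * prob P (good J s `&` good J s') <=
  b j ^+ (k + (k - l.+1)) / (block_lb j ^+ 2 * \prod_(i <- iota 0 j) block_lb i).
Proof.
move=> ss ss' us us' Ds X0 jJ lk disj.
have Ds1 v : v \in s -> D v by move=> vs; apply: Ds; rewrite mem_cat vs.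
have Ds2 v : v \in s' -> D v by move=> vs; apply: Ds; rewrite mem_cat vs orbT.
have bp1 i : (i < J)%N -> 0 < block_prob s i.
  by move=> iJ; apply: lt_le_trans (block_lb_gt0 i) _; exact: (block_prob_ge J).
have bp2 i : (i < J)%N -> 0 < block_prob s' i.
  by move=> iJ; apply: lt_le_trans (block_lb_gt0 i) _; exact: (block_prob_ge J).
have := good_pair_shared J s s' j l ss ss' us us' Ds X0 jJ lk disj.
have split (s0 : seq I) : \prod_(i <- iota 0 J) block_prob s0 i =
    \prod_(i <- iota 0 j) block_prob s0 i * (block_prob s0 j *
    \prod_(i <- iota j.+1 (J - j.+1)) block_prob s0 i).
  have -> : J = (j + (J - j.+1).+1)%N by rewrite -addSnnS subnKC.
  rewrite iotaD big_cat /= add0n big_cons.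
  by rewrite -addSnnS addKn.
rewrite !prob_good // !split.
have a'L : \prod_(i <- iota 0 j) block_lb i <= \prod_(i <- iota 0 j) block_prob s' i.
  rewrite big_seq [leRHS]big_seq; apply: ler_prod => i; rewrite mem_iota => /andP[_ ij].
  rewrite ltW ?block_lb_gt0 //=; apply: (block_prob_ge J) => //; exact: ltn_trans jJ.
have L0 : 0 < \prod_(i <- iota 0 j) block_lb i by apply: prodr_gt0 => i _; exact: block_lb_gt0.
have a0 : 0 < \prod_(i <- iota 0 j) block_prob s i.
  rewrite big_seq; apply: prodr_gt0 => i; rewrite mem_iota => /andP[_ ij].
  by apply: bp1; exact: ltn_trans jJ.
have e0 : 0 < \prod_(i <- iota j.+1 (J - j.+1)) block_prob s i.
  by rewrite big_seq; apply: prodr_gt0 => i; rewrite mem_iota subnKC // => /andP[_ ij]; exact: bp1.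
have e'0 : 0 < \prod_(i <- iota j.+1 (J - j.+1)) block_prob s' i.
  by rewrite big_seq; apply: prodr_gt0 => i; rewrite mem_iota subnKC // => /andP[_ ij]; exact: bp2.
have q0 := bp1 j jJ; have q'0 := bp2 j jJ.
have qr : block_lb j <= block_prob s j by exact: (block_prob_ge J).
have q'r : block_lb j <= block_prob s' j by exact: (block_prob_ge J).
have r0 := block_lb_gt0 j.
have B0 : 0 <= b j ^+ (k + (k - l.+1)) by rewrite exprn_ge0 // ltW.
move: (\prod_(i <- iota 0 j) block_lb i) (\prod_(i <- iota 0 j) block_prob s i)
  (\prod_(i <- iota 0 j) block_prob s' i) (\prod_(i <- iota j.+1 (J - j.+1)) block_prob s i)
  (\prod_(i <- iota j.+1 (J - j.+1)) block_prob s' i) (block_prob s j) (block_prob s' j)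
  (block_lb j) (prob P (good J s `&` good J s')) (b j ^+ (k + (k - l.+1)))
  a'L L0 a0 e0 e'0 q0 q'0 qr q'r r0 B0
  => L a a' e e' q q' r Pr B a'L L0 a0 e0 e'0 q0 q'0 qr q'r r0 B0 Prle.
have a'0 : 0 < a' := lt_le_trans L0 a'L.
apply: (@le_trans _ _ ((a * (q * e))^-1 * (a' * (q' * e'))^-1 * (a * B * (e * e')))).
  by apply: ler_wpM2l => //; rewrite mulr_ge0 // invr_ge0 ltW // !mulr_gt0.
rewrite [leLHS](_ : _ = B / (q * q' * a')); last by field; rewrite !gt_eqF.
apply: ler_wpM2l => //; rewrite lef_pV2 ?posrE ?mulr_gt0 ?exprn_gt0 //.
have rq : r * r <= q * q' by apply: ler_pM => //; exact: ltW.
by rewrite expr2; apply: ler_pM => //; rewrite ?mulr_ge0 // ltW.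
Qed.

End BlockEvents.

(** * The second moment over pairs of paths *)

Section PathPairs.
Context {d : measure_display} {T : measurableType d} {R : realType}.
Variable P : probability T R.
Variables (I : choiceType) (D : set I) (f : nat -> nat) (G : spherical_paths I D f).
Variable X : I -> {RV P >-> R}.
Hypothesis f_gt0 : forall n, (1 <= n)%N -> (1 <= f n)%N.
Hypothesis X_indep : independent_on D X.
Hypothesis X_exp : forall v, D v -> standard_exponential (X v).
Hypothesis X_ge0 : {ae P, forall t n p v, p \in lev G n -> v \in p -> 0 <= X v t}.
Variables (k n : nat) (b : nat -> R).
Hypothesis k_gt0 : (0 < k)%N.
Hypothesis b_gt0 : forall i, 0 < b i.
Hypothesis b_small : forall i, 2^-1 <= expR (- b i).

Local Notation Z := (growth_prod R f).
Local Notation lb := (block_lb k b).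

Definition pair_bound (j l : nat) : R :=
  b j ^+ (k + (k - l.+1)) / (lb j ^+ 2 * \prod_(i <- iota 0 j) lb i).

Lemma pair_bound_ge0 j l : 0 <= pair_bound j l.
Proof.
rewrite divr_ge0 ?exprn_ge0 ?(ltW (b_gt0 j)) // mulr_ge0 ?exprn_ge0 //.
- by rewrite ltW // block_lb_gt0.
- by apply: prodr_ge0 => i _; rewrite ltW // block_lb_gt0.
Qed.

Definition fast_from (J : nat) (p : seq I) : set T := good P I X k b J (drop n p).

(** Only the term of the last common level is used. The sum over all levels after [n] is a cheap
    upper bound that replaces a classification of pairs by their separation level with a count of
    pairs that agree at a given level. Pairs that separate by level [n] are independent and
    contribute 0. *)
Lemma fast_pair_le J p q : p \in lev G (n + J * k) -> q \in lev G (n + J * k) ->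
  (prob P (fast_from J p))^-1 * (prob P (fast_from J q))^-1 *
    prob P (fast_from J p `&` fast_from J q) - 1 <=
  \sum_(j <- iota 0 J) \sum_(l <- iota 0 k)
    pair_bound j l * (take (n + (j * k + l.+1)) q == take (n + (j * k + l.+1)) p)%:R.
Proof.
set L := (n + J * k)%N => pL qL.
have sp := lev_size G _ _ pL; have sq := lev_size G _ _ qL.
have up := uniq_lev_path G _ _ pL; have uq := uniq_lev_path G _ _ qL.
have ss : size (drop n p) = (J * k)%N by rewrite size_drop sp addKn.
have ss' : size (drop n q) = (J * k)%N by rewrite size_drop sq addKn.
have us : uniq (drop n p) := drop_uniq n up.
have us' : uniq (drop n q) := drop_uniq n uq.
have Ds v : v \in drop n p ++ drop n q -> D v.
  by rewrite mem_cat => /orP[/mem_drop vp|/mem_drop vq];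
    [exact: lev_dom pL vp|exact: lev_dom qL vq].
have X0 : {ae P, forall t v, v \in drop n p ++ drop n q -> 0 <= X v t}.
  apply: filterS X_ge0 => t X0 v; rewrite mem_cat => /orP[/mem_drop vp|/mem_drop vq].
    exact: X0 pL vp.
  exact: X0 qL vq.
have term0 j l : 0 <= pair_bound j l * (take (n + (j * k + l.+1)) q == take (n + (j * k + l.+1))
  p)%:R.
  by rewrite mulr_ge0 ?pair_bound_ge0.
have sum0 : 0 <= \sum_(j <- iota 0 J) \sum_(l <- iota 0 k)
    pair_bound j l * (take (n + (j * k + l.+1)) q == take (n + (j * k + l.+1)) p)%:R.
  by apply: sumr_ge0 => j _; apply: sumr_ge0 => l _.
pose agree m := (m <= L)%N && (take m p == take m q).
have ex_agree : exists m, agree m by exists 0%N; rewrite /agree !take0 eqxx.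
have agree_ub m : agree m -> (m <= L)%N by case/andP.
have [m /andP[mL /eqP mpq] mmax] := ex_maxnP ex_agree agree_ub.
have disj v : v \in p -> v \notin drop m q.
  move=> vp; move: mL; rewrite leq_eqVlt => /predU1P[->|mL].
    by rewrite drop_oversize ?sq.
  apply: (lev_disjoint G _ _ _ _ _ _ pL qL) => // mpq1.
  by have := mmax m.+1; rewrite /agree mL mpq1 eqxx ltnn => /(_ isT).
have [mn|nm] := leqP m n.
  have u2 : uniq (drop n p ++ drop n q).
    rewrite cat_uniq us us' andbT /=; apply/hasPn => v vq; apply/negP => vp.
    have := disj v (mem_drop vp); rewrite (_ : drop m q = take (n - m) (drop m q) ++ drop n q).
      by rewrite mem_cat vq orbT.
    by rewrite -{1}(cat_take_drop (n - m) (drop m q)) drop_drop subnK.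
  rewrite /fast_from (good_pair_disjoint P I D X X_indep k b J) //.
  have gp := good_prob_gt0 P I D X X_indep X_exp k b b_gt0 b_small J.
  have {}g1 : 0 < prob P (good P I X k b J (drop n p)).
    by apply: gp => // v vs; apply: Ds; rewrite mem_cat vs.
  have g2 : 0 < prob P (good P I X k b J (drop n q)).
    by apply: gp => // v vs; apply: Ds; rewrite mem_cat vs orbT.
  rewrite (_ : _ - 1 = 0) //; field; by rewrite !gt_eqF.
have n1m : (n.+1 + (m - n.+1))%N = m by rewrite subnKC.
(* Dividing [m - n - 1] rather than [m - n] assigns agreement through the end of a block to that
   block, so [j < J] even when [p = q]. *)
pose j := ((m - n.+1) %/ k)%N; pose l := ((m - n.+1) %% k)%N.
have mE : m = (n + (j * k + l.+1))%N by rewrite addnS -divn_eq addnS -addSn.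
have lk : (l < k)%N by rewrite ltn_mod.
have jJ : (j < J)%N by rewrite ltn_divLR // -(ltn_add2l n.+1) n1m addSn ltnS.
have disj' v : v \in drop n p -> v \notin drop (j * k + l.+1) (drop n q).
  by move=> /mem_drop vp; rewrite drop_drop addnC -mE disj.
have ratio := good_pair_ratio P I D X X_indep X_exp k b b_gt0 b_small J _ _ j l
  ss ss' us us' Ds X0 jJ lk disj'.
apply: (@le_trans _ _ (pair_bound j l)).
  by apply: le_trans ratio; rewrite gerBl.
have iJ : j \in iota 0 J by rewrite mem_iota.
have ik : l \in iota 0 k by rewrite mem_iota.
rewrite (big_rem j) //= (big_rem l) //= -mE mpq eqxx mulr1 -addrA lerDl addr_ge0 //.
  by apply: sumr_ge0.
by apply: sumr_ge0 => j' _; apply: sumr_ge0 => l' _.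
Qed.

Lemma measurable_fast_from J p : measurable (fast_from J p).
Proof. exact: measurable_good. Qed.

(** With [L] the last level, each path agrees at level [m] with [Z L / Z m] paths, so
    [Z L ^ 2 / Z m] pairs agree there; the square of the mean is [Z L ^ 2], which leaves
    [1 / Z m]. *)
Lemma prob_no_fast_path J :
  prob P (~` \big[setU/set0]_(p <- lev G (n + J * k)) fast_from J p) <=
  \sum_(j <- iota 0 J) \sum_(l <- iota 0 k) pair_bound j l / Z (n + (j * k + l.+1)).
Proof.
set L := (n + J * k)%N.
have ZL : 0 < Z L := growth_prod_gt0 f_gt0 L.
have sL : (size (lev G L))%:R = Z L := size_lev G R L.
rewrite -(ler_pM2l (exprn_gt0 2 ZL)) -sL.
apply: le_trans (second_moment P _ (lev G L) (fast_from J) (fun p =>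
  (prob P (fast_from J p))^-1) _ _) _.
- by move=> p _; exact: measurable_fast_from.
- move=> p pL; rewrite mulVf // gt_eqF //.
  apply: (good_prob_gt0 P I D X X_indep X_exp k b b_gt0 b_small).
  + by rewrite size_drop (lev_size G _ _ pL) addKn.
  + by rewrite drop_uniq // (uniq_lev_path G _ _ pL).
  + by move=> v /mem_drop vp; exact: lev_dom pL vp.
apply: (@le_trans _ _ (\sum_(p <- lev G L) \sum_(q <- lev G L)
  \sum_(j <- iota 0 J) \sum_(l <- iota 0 k)
    pair_bound j l * (take (n + (j * k + l.+1)) q == take (n + (j * k + l.+1)) p)%:R)).
  rewrite big_seq [leRHS]big_seq; apply: ler_sum => p pL.
  rewrite big_seq [leRHS]big_seq; apply: ler_sum => q qL.
  exact: fast_pair_le.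
under eq_bigr do rewrite exchange_big.
rewrite exchange_big mulr_sumr big_seq [leRHS]big_seq; apply: ler_sum => j.
rewrite mem_iota add0n => /andP[_ jJ].
under eq_bigr do rewrite exchange_big.
rewrite exchange_big mulr_sumr big_seq [leRHS]big_seq; apply: ler_sum => l.
rewrite mem_iota add0n => /andP[_ lk].
set m := (n + (j * k + l.+1))%N.
have mL : (m <= L)%N.
  rewrite leq_add2l (leq_trans (_ : _ <= j.+1 * k)%N) //.
    by rewrite mulSn addnC leq_add2r.
  by rewrite leq_mul2r jJ orbT.
have Zm : 0 < Z m := growth_prod_gt0 f_gt0 m.
rewrite le_eqVlt; apply/orP; left; apply/eqP.
rewrite big_seq (eq_bigr (fun=> pair_bound j l * (Z L / Z m))).
  rewrite -big_seq big_const_seq count_predT iter_addr_0 -[LHS]mulr_natr sL.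
  by field; rewrite gt_eqF.
move=> p pL; rewrite -mulr_sumr; congr (_ * _).
rewrite -natr_sum; have := lev_countR G R L m (take m p) (lev_take G _ _ _ pL mL) mL.
rewrite -sum1_count big_mkcond /= => <-; rewrite mulfK ?gt_eqF //.
Qed.

End PathPairs.

(** * The pair bounds for the chosen caps *)

Section PairBoundEstimate.
Context {R : realType} {f : nat -> nat}.
Hypothesis f_gt0 : forall n, (1 <= n)%N -> (1 <= f n)%N.
Variables (k n : nat) (c : R).
Hypotheses (k_gt0 : (0 < k)%N) (kc1 : 1 <= k%:R * c) (kcf : 4 * k`!%:R <= (k%:R * c) ^+ k).

Local Notation phi := (ftilde R f).
Local Notation c_ := (ftilde_prod R f).
Local Notation Z := (growth_prod R f).

(* [ftilde] is taken at the first level of the block, where it is smallest, so that the product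
   of these values, one for each level, is at most [c_]. The sums of the caps are compared with
   those of the inverses of [ftilde] after a shift by one block. *)
Definition time_cap (j : nat) : R := k%:R * c / phi (n + j * k).+1.
Local Notation lb := (block_lb k time_cap).

Lemma time_cap_gt0 j : 0 < time_cap j.
Proof. by rewrite divr_gt0 ?ftilde_gt0 // (lt_le_trans _ kc1). Qed.

Lemma time_cap_le j : time_cap j <= time_cap 0.
Proof.
rewrite /time_cap mul0n addn0 ler_wpM2l ?(le_trans _ kc1) //.
by rewrite lef_pV2 ?posrE ?ftilde_gt0 // ftilde_le // ltnS leq_addr.
Qed.

(** Of the constant 4 in [kcf], one factor 2 is spent on the density in [block_lb]; the other is the
    gain per block that makes the sum over [j] converge. *)
Lemma block_lb_time_cap j : 2 / phi (n + j * k).+1 ^+ k <= lb j.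
Proof.
have p0 := ftilde_gt0 (R := R) f_gt0 (n + j * k).+1 isT.
have kf : 0 < (k`!%:R : R) by rewrite ltr0n fact_gt0.
rewrite /block_lb /time_cap expr_div_n.
have pk0 : 0 < phi (n + j * k).+1 ^+ k by rewrite exprn_gt0.
rewrite ler_pdivlMr // ler_pdivlMr //.
rewrite [leLHS](_ : _ = 4 * k`!%:R / phi (n + j * k).+1 ^+ k); last first.
  by move: pk0; move: (phi _ ^+ k) => x x0; field; rewrite gt_eqF.
by rewrite ler_wpM2r // invr_ge0 ltW.
Qed.

Lemma growth_prod_blocks j l :
  c_ n * (\prod_(i <- iota 0 j) phi (n + i * k).+1 ^+ k) * phi (n + j * k).+1 ^+ l
    <= Z (n + (j * k + l)).
Proof.
apply: le_trans (ftilde_prod_le f_gt0 _); rewrite addnA.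
apply: le_trans (ftilde_prodD_ge f_gt0 _ _); rewrite mulrC.
rewrite ler_wpM2l ?exprn_ge0 ?(ltW (ftilde_gt0 f_gt0 _ _)) //.
elim: j => [|j IH]; first by rewrite big_nil mulr1 addn0.
rewrite -[j.+1]addn1 iotaD big_cat /= add0n big_seq1 addn1 mulSnr addnA.
apply: le_trans (ftilde_prodD_ge f_gt0 _ _); rewrite mulrA mulrC.
by rewrite ler_wpM2l ?exprn_ge0 ?(ltW (ftilde_gt0 f_gt0 _ _)).
Qed.

(** After cancellation the power [l.+1] of the cap remains in the denominator. It is paid by the
    [l.+1] levels of block [j] counted in [Z], since cap times [ftilde] is [k * c >= 1]; the earlier
    blocks cancel against [Z] up to the gain [2 ^ j]. *)
Lemma pair_bound_le j l : (l < k)%N ->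
  pair_bound k time_cap j l / Z (n + (j * k + l.+1)) <=
  4 * k`!%:R ^+ 2 * 2^-1 ^+ j / c_ n.
Proof.
move=> lk; have p0 i := ftilde_gt0 (R := R) f_gt0 (n + i * k).+1 isT.
have kf : 0 < (k`!%:R : R) by rewrite ltr0n fact_gt0.
have t0 := time_cap_gt0 j.
have cn0 := ftilde_prod_gt0 (R := R) f_gt0 n.
set Ph := \prod_(i <- iota 0 j) phi (n + i * k).+1 ^+ k.
have Ph0 : 0 < Ph by apply: prodr_gt0 => i _; rewrite exprn_gt0.
have L0 : 0 < \prod_(i <- iota 0 j) lb i by apply: prodr_gt0 => i _;
  exact: block_lb_gt0 time_cap_gt0 _.
have Lge : 2 ^+ j / Ph <= \prod_(i <- iota 0 j) lb i.
  have -> : 2 ^+ j = \prod_(i <- iota 0 j) 2 :> R.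
    by rewrite big_const_seq count_predT size_iota iter_mulr_1.
  rewrite /Ph -prodfV -big_split /=.
  apply: ler_prod => i _; rewrite block_lb_time_cap andbT divr_ge0 // exprn_ge0 // ltW //.
have E1 : pair_bound k time_cap j l =
    4 * k`!%:R ^+ 2 / (time_cap j ^+ l.+1 * \prod_(i <- iota 0 j) lb i).
  rewrite /pair_bound /block_lb.
  have -> : time_cap j ^+ (k + (k - l.+1)) = time_cap j ^+ k * time_cap j ^+ k / time_cap j ^+ l.+1.
    apply: (canRL (mulfK _)); first by rewrite gt_eqF ?exprn_gt0.
    by rewrite -!exprD -addnA subnK.
  have tk0 : 0 < time_cap j ^+ k by rewrite exprn_gt0.
  have tl0 : 0 < time_cap j ^+ l.+1 by rewrite exprn_gt0.
  move: (time_cap j ^+ k) (time_cap j ^+ l.+1) (\prod_(i <- iota 0 j) _) tk0 tl0 L0 =>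
    x y z x0 y0 z0.
  by field; rewrite !gt_eqF.
have Zge := growth_prod_blocks j l.+1; rewrite -/Ph in Zge.
set q := phi (n + j * k).+1 in Zge; have q0 : 0 < q := p0 j.
have tq : 1 <= time_cap j ^+ l.+1 * q ^+ l.+1.
  rewrite -exprMn /time_cap -/q mulfVK ?gt_eqF //.
  by rewrite exprn_ege1.
have ql0 : 0 < q ^+ l.+1 by rewrite exprn_gt0.
have tl0 : 0 < time_cap j ^+ l.+1 by rewrite exprn_gt0.
rewrite E1 -[leLHS]mulrA -[leRHS]mulrA ler_wpM2l //.
have Z0 : 0 < Z (n + (j * k + l.+1)) := growth_prod_gt0 f_gt0 _.
have two : 0 < 2 ^+ j :> R by rewrite exprn_gt0.
rewrite -invfM exprVn -invfM lef_pV2 ?posrE ?mulr_gt0 //.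
apply: (@le_trans _ _ ((time_cap j ^+ l.+1 * (2 ^+ j / Ph)) * (c_ n * Ph * q ^+ l.+1))); last first.
  apply: ler_pM => //.
  - by rewrite mulr_ge0 ?divr_ge0 // ltW.
  - by rewrite !mulr_ge0 // ltW.
  - by rewrite ler_wpM2l // ltW.
rewrite [leRHS](_ : _ = 2 ^+ j * c_ n * (time_cap j ^+ l.+1 * q ^+ l.+1)).
  by rewrite ler_peMr // mulr_ge0 // ltW.
by field; rewrite gt_eqF.
Qed.

Lemma sum_half_le J : \sum_(j <- iota 0 J) 2^-1 ^+ j <= 2 :> R.
Proof.
suff : \sum_(j <- iota 0 J) 2^-1 ^+ j = 2 - 2 * 2^-1 ^+ J :> R.
  by move=> ->; rewrite gerBl mulr_ge0 // exprn_ge0 // invr_ge0.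
elim: J => [|J IH]; first by rewrite big_nil expr0 mulr1 subrr.
by rewrite -[J.+1]addn1 iotaD big_cat /= add0n big_seq1 IH addn1 exprS; field.
Qed.

Lemma sum_pair_bound_le J :
  \sum_(j <- iota 0 J) \sum_(l <- iota 0 k)
    pair_bound k time_cap j l / Z (n + (j * k + l.+1)) <=
  8 * k%:R * k`!%:R ^+ 2 / c_ n.
Proof.
have cn0 := ftilde_prod_gt0 (R := R) f_gt0 n.
apply: (@le_trans _ _ (\sum_(j <- iota 0 J) (4 * k%:R * k`!%:R ^+ 2 / c_ n) * 2^-1 ^+ j)).
  apply: ler_sum => j _.
  apply: (@le_trans _ _ (\sum_(l <- iota 0 k) 4 * k`!%:R ^+ 2 * 2^-1 ^+ j / c_ n)).
    rewrite big_seq [leRHS]big_seq; apply: ler_sum => l; rewrite mem_iota => /andP[_ lk].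
    exact: pair_bound_le.
  rewrite big_const_seq count_predT size_iota iter_addr_0 -[leLHS]mulr_natr.
  by rewrite le_eqVlt; apply/orP; left; apply/eqP; field; rewrite gt_eqF.
rewrite -mulr_sumr [leRHS](_ : _ = (4 * k%:R * k`!%:R ^+ 2 / c_ n) * 2); last by field;
  rewrite gt_eqF.
rewrite ler_wpM2l ?sum_half_le // divr_ge0 ?(ltW cn0) // mulr_ge0 // ?exprn_ge0 // mulr_ge0 //.
Qed.

End PairBoundEstimate.

Section HarmonicSums.
Context {R : realType} {f : nat -> nat}.
Hypothesis f_gt0 : forall n, (1 <= n)%N -> (1 <= f n)%N.
Local Notation phi := (ftilde R f).
Local Notation c_ := (ftilde_prod R f).

Definition inv_sum (m : nat) : R := \sum_(1 <= i < m.+1) (phi i)^-1.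

Lemma inv_sumS m : inv_sum m.+1 = inv_sum m + (phi m.+1)^-1.
Proof. by rewrite /inv_sum big_nat_recr. Qed.

Lemma inv_sum_le m m' : (m <= m')%N -> inv_sum m <= inv_sum m'.
Proof.
move=> /subnKC <-; elim: (m' - m)%N => [|a IH]; first by rewrite addn0.
by rewrite addnS inv_sumS (le_trans IH) // lerDl invr_ge0 ltW // ftilde_gt0.
Qed.

Lemma inv_sumD_ge m k a : (a <= k)%N ->
  inv_sum m + a%:R / phi (m + k).+1 <= inv_sum (m + a).
Proof.
elim: a => [|a IH] ak; first by rewrite mul0r addr0 addn0.
rewrite addnS inv_sumS -natr1 mulrDl addrA mul1r lerD ?IH // 1?ltnW //.
by rewrite lef_pV2 ?posrE ?ftilde_gt0 // ftilde_le // ltnS leq_add2l ltnW.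
Qed.

Lemma ftilde_prod_ge1 n : 1 <= c_ n.
Proof.
elim: n => [|n IH] //; rewrite ftilde_prodS -[leLHS]mulr1 ler_pM //.
exact: ftilde_ge1.
Qed.

Lemma ftilde_prod_unbounded : (forall B : R, exists n, (1 <= n)%N /\ B < phi n) ->
  forall (B : R) N, exists2 n, (N <= n)%N & B < c_ n.
Proof.
move=> unb B N; have [n [n1 Bn]] := unb (Num.max B (phi N.+1)).
move: Bn; rewrite gt_max => /andP[Bn Nn].
exists n.
  rewrite leqNgt; apply/negP => nN; move: Nn; apply/negP; rewrite -leNgt.
  by apply: ftilde_le => //; rewrite (leq_trans (ltnW nN)).
case: n n1 Bn {Nn} => // n _ Bn; rewrite ftilde_prodS (lt_le_trans Bn) //.
by rewrite ler_peMl ?ftilde_prod_ge1 // ltW // ftilde_gt0.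
Qed.

Lemma sum_time_cap_le k n c J : (0 < k)%N -> 0 <= c ->
  \sum_(j <- iota 0 J.+1) time_cap (f := f) k n c j <= time_cap (f :=
    f) k n c 0 + c * inv_sum (n + J * k).
Proof.
move=> k0 c0; suff : \sum_(j <- iota 0 J.+1) time_cap (f := f) k n c j <=
    time_cap (f := f) k n c 0 + c * (inv_sum (n + J * k) - inv_sum n).
  move=> /le_trans; apply; rewrite lerD2l ler_wpM2l // gerBl.
  by rewrite (le_trans _ (inv_sum_le 0 n (leq0n n))) // /inv_sum big_geq.
elim: J => [|J IH]; first by rewrite /= big_seq1 mul0n addn0 subrr mulr0 addr0.
rewrite -[J.+2]addn1 iotaD big_cat /= big_seq1 add0n.
apply: le_trans (lerD IH (lexx _)) _.
rewrite -addrA lerD2l -lerBrDl -mulrBr opprB addrA subrK.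
rewrite /time_cap mulrAC mulrC ler_wpM2l // lerBrDl mulSnr addnA.
by have := inv_sumD_ge (n + J * k) k k (leqnn k).
Qed.

End HarmonicSums.

(** * From surviving blocks to the almost sure upper bound *)

Section UpperBound.
Context {d : measure_display} {T : measurableType d} {R : realType}.
Variable P : probability T R.
Variables (I : choiceType) (D : set I) (f : nat -> nat) (G : spherical_paths I D f).
Variable X : I -> {RV P >-> R}.
Hypothesis f_gt0 : forall n, (1 <= n)%N -> (1 <= f n)%N.
Hypothesis X_indep : independent_on D X.
Hypothesis X_exp : forall v, D v -> standard_exponential (X v).

Local Notation phi := (ftilde R f).
Local Notation c_ := (ftilde_prod R f).

Definition fast_level (k n : nat) (b : nat -> R) (J : nat) : set T :=
  \big[setU/set0]_(p <- lev G (n + J * k)) fast_from P I X k n b J p.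

Lemma measurable_fast_level k n b J : measurable (fast_level k n b J).
Proof.
by apply: (proj1 (measure_bigsetU_seq P _ _ _ _)) => p _; exact: measurable_fast_from.
Qed.

Lemma wsum1 g t : wsum P I X (fun=> 1) g t = \sum_(v <- g) X v t.
Proof. by apply: eq_bigr => v _; rewrite mul1r. Qed.

Lemma fast_levelP k n b J t : fast_level k n b J t <->
  exists2 p, p \in lev G (n + J * k) &
    forall i, (i < J)%N -> \sum_(v <- block k (drop n p) i) X v t <= b i.
Proof.
rewrite /fast_level -bigcup_seq; split => -[p /= pL gp]; exists p => //.
  move: gp; rewrite /fast_from /good -bigcap_seq => gp i iJ.
  by have := gp i; rewrite /= mem_iota => /(_ iJ); rewrite /sum_le_event /= wsum1.
rewrite /fast_from /good -bigcap_seq => i /=; rewrite mem_iota => /andP[_ iJ].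
by rewrite /sum_le_event /= wsum1; exact: gp.
Qed.

Lemma fast_level_antitone k n b J : fast_level k n b J.+1 `<=` fast_level k n b J.
Proof.
move=> t /fast_levelP[p pL gp]; apply/fast_levelP.
have le : (n + J * k <= n + J.+1 * k)%N by rewrite leq_add2l leq_mul2r leqnSn orbT.
exists (take (n + J * k) p); first exact: (lev_take G _ _ _ pL le).
move=> i iJ; apply: le_trans (gp i (ltnW iJ)).
rewrite addnC -take_drop /block.
have ik : (i * k + k <= J * k)%N by rewrite addnC -mulSn leq_mul2r iJ orbT.
rewrite -(subnK (leq_trans (leq_addr _ _) ik)) -take_drop take_takel //.
by rewrite leq_subRL ?(leq_trans (leq_addr _ _) ik).
Qed.

Lemma prob_not_fast_level (c : R) k n J : (0 < k)%N -> 1 <= k%:R * c ->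
  4 * k`!%:R <= (k%:R * c) ^+ k -> 2 * (k%:R * c) <= phi n.+1 ->
  (P (~` fast_level k n (time_cap (f := f) k n c) J) <=
   (8 * k%:R * k`!%:R ^+ 2 / c_ n)%:E)%E.
Proof.
move=> k0 kc1 kcf small.
have X0 := ae_labels_ge0 P I D f G X X_exp.
have b0 := time_cap_gt0 f_gt0 k n c kc1.
have bs i : 2^-1 <= expR (- time_cap (f := f) k n c i).
  apply: le_trans (expR_ge1Dx _).
  have := time_cap_le f_gt0 k n c kc1 i.
  (* The first cap is the largest, and a cap of at most 1/2 gives [expR (- b) >= 1 - b >= 1/2]. *)
  have : time_cap (f := f) k n c 0 <= 2^-1.
    rewrite /time_cap mul0n addn0 ler_pdivrMr ?ftilde_gt0 //.
    by rewrite -ler_pdivrMl ?invr_gt0 // invrK.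
  lra.
have := prob_no_fast_path P I D f G X f_gt0 X_indep X_exp X0 k n _ k0 b0 bs J.
move=> /le_trans /(_ (sum_pair_bound_le f_gt0 k n c kc1 kcf J)).
by rewrite -lee_fin -probE //; apply: measurableC; exact: measurable_fast_level.
Qed.

(** The failure probability is bounded uniformly in [J], so it passes to the increasing union over
    [J]. Failure for every starting level [n] then has probability at most a constant over [c_ n],
    for arbitrarily large [c_ n]. *)
Lemma ae_fast_level (c : R) k : (0 < k)%N -> 1 <= k%:R * c ->
  4 * k`!%:R <= (k%:R * c) ^+ k -> (forall B : R, exists n, (1 <= n)%N /\ B < phi n) ->
  {ae P, forall t, exists n, forall J, fast_level k n (time_cap (f := f) k n c) J t}.
Proof.
move=> k0 kc1 kcf unb.
pose A n J := ~` fast_level k n (time_cap (f := f) k n c) J.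
have mA n J : measurable (A n J) by apply: measurableC; exact: measurable_fast_level.
pose U n := \bigcup_J A n J.
have mU n : measurable (U n) by exact: bigcupT_measurable.
have PU n : 2 * (k%:R * c) <= phi n.+1 -> (P (U n) <= (8 * k%:R * k`!%:R ^+ 2 / c_ n)%:E)%E.
  move=> small.
  have ndA : nondecreasing_seq (A n).
    apply/nondecreasing_seqP => J; apply/subsetPset; apply: subsetC.
    exact: fast_level_antitone.
  have cvgA := nondecreasing_cvg_mu (mu := P) (mA n) (mU n) ndA.
  rewrite -(cvg_lim _ cvgA) //; apply: lime_le; first by apply/cvg_ex; exists (P (U n)).
  by apply: nearW => J; exact: prob_not_fast_level.
exists (\bigcap_n U n); split.
- exact: bigcapT_measurable.
- apply/eqP; rewrite eq_le measure_ge0 andbT.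
  have mcap : measurable (\bigcap_n U n) by exact: bigcapT_measurable.
  rewrite (probE P) // lee_fin leNgt; apply/negP => p0.
  set p := prob P _ in p0; pose K : R := 8 * k%:R * k`!%:R ^+ 2.
  have [N [N1 Nsmall]] := unb (2 * (k%:R * c)).
  have [n Nn cn] := ftilde_prod_unbounded f_gt0 unb (K / p) N.
  have small : 2 * (k%:R * c) <= phi n.+1.
    by rewrite (le_trans (ltW Nsmall)) // ftilde_le // ltnW // ltnS.
  have : p <= K / c_ n.
    rewrite /p -lee_fin -probE //; apply: le_trans (PU n small).
    by apply: le_measure; rewrite ?inE //; exact: bigcap_inf.
  apply/negP; rewrite -ltNge ltr_pdivrMr ?ftilde_prod_gt0 //.
  by rewrite -ltr_pdivrMl // mulrC.
- move=> t /= /forallNP h n _; have := h n => /existsNP[J hJ].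
  by exists J.
Qed.

Lemma sum_blocks k s J (F : I -> R) : size s = (J * k)%N ->
  \sum_(v <- s) F v = \sum_(i <- iota 0 J) \sum_(v <- block k s i) F v.
Proof.
move=> ss; have := flatten_block k s 0 J; rewrite mul0n drop0 -ss take_size => sE.
by rewrite -{1}sE big_flatten big_map.
Qed.

(** The first [n] vertices may change with [J]; the total over all paths of level [n] bounds them by
    a number independent of [p] and [J]. *)
Lemma sum_fast_path_le k n c J p t : (0 < k)%N -> 0 <= c ->
  (forall n p v, p \in lev G n -> v \in p -> 0 <= X v t) ->
  p \in lev G (n + J.+1 * k) ->
  (forall i, (i < J.+1)%N -> \sum_(v <- block k (drop n p) i) X v t <= time_cap (f := f) k n c i) ->
  \sum_(v <- p) X v t <= \sum_(u <- lev G n) \sum_(v <- u) X v t +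
    time_cap (f := f) k n c 0 + c * inv_sum (f := f) (n + J * k).
Proof.
move=> k0 c0 X0 pL gp; rewrite -addrA -[in leLHS](cat_take_drop n p) big_cat /= lerD //.
  have tn : take n p \in lev G n by apply: lev_take pL _; exact: leq_addr.
  rewrite (big_rem (take n p)) //= lerDl big_seq; apply: sumr_ge0 => u ul.
  rewrite big_seq; apply: sumr_ge0 => v vu; apply: X0 vu.
  exact: mem_rem ul.
rewrite (sum_blocks k _ J.+1); last by rewrite size_drop (lev_size G _ _ pL) addKn.
apply: le_trans (sum_time_cap_le f_gt0 k n c J k0 c0).
rewrite big_seq [leRHS]big_seq; apply: ler_sum => i; rewrite mem_iota => /andP[_ iJ].
exact: gp.
Qed.

Lemma ae_upper_bound (c : R) : expR (-1) < c ->
  (forall B : R, exists n, (1 <= n)%N /\ B < phi n) ->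
  {ae P, forall t, exists B : R, exists N0, forall N, (N0 <= N)%N ->
    exists2 p, p \in lev G N &
      \sum_(v <- p) X v t <= c * inv_sum (f := f) N + B}.
Proof.
move=> ce unb; have c0 : 0 <= c by rewrite ltW // (lt_trans _ ce) // expR_gt0.
have [k k0 [kc1 kcf]] := block_length c ce.
have H := ae_fast_level c k k0 kc1 kcf unb.
apply: filterS2 H (ae_labels_ge0 P I D f G X X_exp) => t [n fast] X0.
exists (\sum_(u <- lev G n) \sum_(v <- u) X v t + time_cap (f := f) k n c 0).
(* The fast path is taken through block [J], which reaches level [N] or beyond, and is then cut at
   [N]. The shift by one block in [sum_fast_path_le] brings the comparison back to level
   [n + J * k <= N]. *)
exists n => N nN; pose J := ((N - n) %/ k)%N.
have JN : (n + J * k <= N)%N by rewrite -leq_subRL // leq_divM.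
have NJ : (N <= n + J.+1 * k)%N by rewrite -leq_subLR ltnW // ltn_ceil.
have /fast_levelP[p pL gp] := fast J.+1.
exists (take N p); first exact: (lev_take G _ _ _ pL NJ).
apply: (@le_trans _ _ (\sum_(v <- p) X v t)).
  rewrite -[in leRHS](cat_take_drop N p) big_cat /= lerDl big_seq.
  by apply: sumr_ge0 => v /mem_drop vp; exact: X0 pL vp.
apply: le_trans (sum_fast_path_le k n c J p t k0 c0 X0 pL gp) _.
by rewrite addrC lerD2r ler_wpM2l // inv_sum_le.
Qed.

End UpperBound.

(** * Paths in a rooted tree *)

Section TreePaths.
Variable G : rooted_tree.
Local Notation root := (tree_root G).
Local Notation pi := (@path_from_root G).

Lemma path_from_rootP (v : G) : simple_path (@adj G) root v (pi v).
Proof. exact: xchooseP. Qed.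

Lemma path_from_root_unique (v : G) p : simple_path (@adj G) root v p -> pi v = p.
Proof.
move=> sp; have [q [_ uq]] := adj_tree root v.
by rewrite -(uq _ sp); apply/esym/uq; exact: path_from_rootP.
Qed.

Lemma last_path_from_root (v : G) : last root (pi v) = v.
Proof. by have /and3P[_ _ /eqP] := path_from_rootP v. Qed.

Lemma take_path_from_root (v : G) i :
  pi (last root (take i (pi v))) = take i (pi v).
Proof.
apply: path_from_root_unique; have /and3P[pa un _] := path_from_rootP v.
rewrite /simple_path eqxx andbT take_path //=.
by move: un => /= /andP[rn un]; rewrite take_uniq // andbT; apply: contra rn => /mem_take.
Qed.

Lemma path_from_root_nth (v v0 : G) i : (i < depth v)%N ->
  pi (nth v0 (pi v) i) = take i.+1 (pi v).
Proof.
move=> iv; rewrite -[RHS]take_path_from_root; congr path_from_root.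
by rewrite (take_nth v0) // last_rcons.
Qed.

Lemma path_from_root_child (v w : G) : children v w -> pi w = rcons (pi v) w.
Proof.
move=> [vw dvw]; apply: path_from_root_unique.
have /and3P[pa un /eqP la] := path_from_rootP v.
have wr : root != w.
  apply/eqP => wr; move: dvw; rewrite {2}/depth -wr (path_from_root_unique root [::]) //.
  by rewrite /simple_path /= eqxx.
(* A vertex on the path to [v] has a prefix of that path as its own path, so it cannot be deeper
   than [v]. *)
have wv : w \notin pi v.
  apply/negP => wv; move: dvw; rewrite ltnNge => /negP; apply.
  rewrite {1}/depth -(nth_index w wv) path_from_root_nth ?index_mem //.
  by rewrite size_take; case: ifP => // ?; rewrite /depth index_mem.
move: un; rewrite /simple_path rcons_path pa la vw last_rcons eqxx andbT /= => /andP[rn un].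
by rewrite mem_rcons inE negb_or wr rn rcons_uniq wv un.
Qed.

Lemma depth_child (v w : G) : children v w -> depth w = (depth v).+1.
Proof. by move=> /path_from_root_child e; rewrite /depth e size_rcons. Qed.

Lemma path_from_rootS n (w : G) : depth w = n.+1 ->
  exists v, [/\ depth v = n, children v w & pi w = rcons (pi v) w].
Proof.
move=> dw; have := last_path_from_root w; have /and3P[pa _ _] := path_from_rootP w.
have := take_path_from_root w n; move: dw; rewrite /depth.
case/lastP pw: (pi w) pa => [|q w'] // pa; rewrite size_rcons => -[sq].
rewrite -cats1 take_cat sq ltnn subnn take0 cats0 cats1 last_rcons => qE w'E.
move: pa; rewrite rcons_path w'E => /andP[_ adjw].
exists (last root q); split.
- by rewrite /depth qE.
- by split => //; rewrite /depth qE pw size_rcons.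
- by rewrite qE.
Qed.

Lemma path_from_root_dom (v w : G) : w \in pi v -> w <> root.
Proof.
have /and3P[_ + _] := path_from_rootP v => /= /andP[rn _] wv wr.
by move: rn; rewrite -wr wv.
Qed.

Variable f : nat -> nat.
Hypothesis G_sym : spherically_symmetric G f.

Lemma children_enum : {ch : G -> seq G & forall v,
  [/\ uniq (ch v), size (ch v) = f (depth v).+1 & forall w, w \in ch v <-> children v w]}.
Proof.
apply: (boolp.choice (P := fun v (s : seq G) =>
  [/\ uniq s, size s = f (depth v).+1 & forall w, w \in s <-> children v w])) => v.
have cv := G_sym v.
have /finite_fsetP[A AE] : finite_set (children v) by exists (f (depth v).+1).
exists (finmap.enum_fset A); split; first exact: finmap.fset_uniq.
  by have := cv; rewrite AE => /card_eq_fsetP.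
by move=> w; rewrite AE.
Qed.

Definition tree_child := projT1 children_enum.

Lemma uniq_tree_child v : uniq (tree_child v).
Proof. by have [] := projT2 children_enum v. Qed.

Lemma size_tree_child v : size (tree_child v) = f (depth v).+1.
Proof. by have [] := projT2 children_enum v. Qed.

Lemma mem_tree_child v w : w \in tree_child v <-> children v w.
Proof. by have [_ _] := projT2 children_enum v; exact. Qed.

Fixpoint tree_lev (n : nat) : seq (seq G) :=
  if n is m.+1 then [seq rcons p w | p <- tree_lev m, w <- tree_child (last root p)]
  else [:: [::]].

Lemma tree_levP n p : p \in tree_lev n <-> exists2 v, depth v = n & p = pi v.
Proof.
elim: n p => [|n IH] p /=.
  rewrite inE; split=> [/eqP ->|[v /size0nil e ->]]; last by rewrite e.
  have e : pi root = [::] by apply: path_from_root_unique; rewrite /simple_path /= eqxx.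
  by exists root; rewrite ?e // /depth e.
split=> [/allpairsPdep[q [w [/IH[v dv ->] + ->]]]|[w dw ->]].
  rewrite last_path_from_root => /mem_tree_child cw; exists w.
    by rewrite (depth_child v w cw) dv.
  by rewrite (path_from_root_child v w cw).
have [v [dv cw ->]] := path_from_rootS n w dw.
apply/allpairsPdep; exists (pi v), w; split => //; first by apply/IH; exists v.
by rewrite last_path_from_root; apply/mem_tree_child.
Qed.

Lemma size_tree_lev n p : p \in tree_lev n -> size p = n.
Proof. by move=> /tree_levP[v dv ->]. Qed.

Lemma uniq_tree_lev n : uniq (tree_lev n).
Proof.
elim: n => // n IH; apply: allpairs_uniq_dep => //.
- by move=> p _; exact: uniq_tree_child.
- by move=> [p v] [q w] _ _ /= /rcons_inj[-> ->].
Qed.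

Lemma take_tree_lev n l p : p \in tree_lev n -> (l <= n)%N -> take l p \in tree_lev l.
Proof.
move=> /tree_levP[v dv ->] ln; apply/tree_levP.
exists (last root (take l (pi v))); last by rewrite take_path_from_root.
by rewrite /depth take_path_from_root size_takel // -/(depth v) dv.
Qed.

Lemma count_tree_lev n l r : r \in tree_lev l -> (l <= n)%N ->
  (count (fun q => take l q == r) (tree_lev n) * \prod_(1 <= i < l.+1) f i =
   \prod_(1 <= i < n.+1) f i)%N.
Proof.
move=> rl; elim: n => [|n IH].
  by rewrite leqn0 => /eqP l0; move: rl; rewrite l0 /= inE => /eqP ->; rewrite big_geq.
rewrite leq_eqVlt => /predU1P[ln|ln].
  have -> : count (fun q => take l q == r) (tree_lev n.+1) = 1%N; last by rewrite ln mul1n.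
  rewrite (eq_in_count (a2 := pred1 r)) => [|q qn]; last first.
    by rewrite /= -[in RHS](take_size q) (size_tree_lev _ _ qn) ln.
  by rewrite count_uniq_mem ?uniq_tree_lev // -ln rl.
rewrite ltnS in ln; rewrite [in RHS]big_nat_recr //= -IH // [RHS]mulnAC; congr (_ * _)%N.
rewrite count_flatten -map_comp.
have -> : [seq (count (fun q => take l q == r) \o
    (fun p => [seq rcons p w | w <- tree_child (last root p)])) p | p <- tree_lev n] =
    [seq ((take l p == r) * f n.+1)%N | p <- tree_lev n].
  apply/eq_in_map => p pn /=; rewrite count_map.
  rewrite (eq_count (a2 := fun=> take l p == r)) => [|w]; last first.
    by rewrite /= -cats1 takel_cat // (size_tree_lev _ _ pn).
  have /tree_levP[v dv pv] := pn.
  case: eqP => _; last by rewrite count_pred0 mul0n.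
  by rewrite count_predT mul1n pv last_path_from_root size_tree_child dv.
elim: (tree_lev n) => //= p s ->; by rewrite mulnDl.
Qed.

Definition tree_spherical_paths : spherical_paths G [set v : G | v <> root] f.
Proof.
apply: (@SphericalPaths _ _ _ tree_lev pi).
- by [].
- exact: uniq_tree_lev.
- exact: size_tree_lev.
- exact: take_tree_lev.
- exact: count_tree_lev.
- by move=> n p v /tree_levP[w _ ->]; exact: path_from_root_dom.
- by move=> n p v0 i /tree_levP[w dw ->] iv; apply: path_from_root_nth; rewrite dw.
Defined.

Lemma lev_tree_spherical_paths n p :
  p \in lev tree_spherical_paths n <-> exists2 v, depth v = n & p = pi v.
Proof. exact: tree_levP. Qed.

Section FirstPassage.
Context {R : realType}.
Variable x : G -> R.

Lemma first_passage_le n p : p \in lev tree_spherical_paths n ->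
  first_passage x n <= \sum_(v <- p) x v.
Proof.
move=> pn; apply: ge_inf; last first.
  by have /lev_tree_spherical_paths[v dv ->] := pn; exists v.
(* The infimum is meaningful only for a set bounded below; the labels are arbitrary reals here, so a
   bound is built from the finite level. *)
exists (- \sum_(p <- lev tree_spherical_paths n) `|\sum_(v <- p) x v|) => _ [v /= dv <-].
have pv : pi v \in lev tree_spherical_paths n by apply/lev_tree_spherical_paths; exists v.
rewrite lerNl (big_rem (pi v)) //=.
rewrite (le_trans (ler_norm _)) // normrN lerDl.
by apply: sumr_ge0.
Qed.

Lemma le_first_passage n B : lev tree_spherical_paths n != [::] ->
  (forall p, p \in lev tree_spherical_paths n -> B <= \sum_(v <- p) x v) ->
  B <= first_passage x n.
Proof.
move=> ne lB; apply: lb_le_inf.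
  case: (lev tree_spherical_paths n) ne (lev_tree_spherical_paths n) => // p s _ /(_ p).
  by rewrite inE eqxx => -[/(_ isT)[v dv _] _]; exists (passage_time x v), v.
move=> _ [v /= dv <-]; apply: lB; apply/lev_tree_spherical_paths; by exists v.
Qed.

(** The infimum over a finite nonempty level is attained. This writes the event [M n <= B] as a
    finite union, from which the explosion event is seen to be measurable. *)
Lemma first_passage_le_iff n B : lev tree_spherical_paths n != [::] ->
  first_passage x n <= B <->
  exists2 p, p \in lev tree_spherical_paths n & \sum_(v <- p) x v <= B.
Proof.
move=> ne; split=> [fB|[p pn pB]]; last exact: le_trans (first_passage_le _ _ pn) pB.
have [p0 p0n] : exists p, p \in lev tree_spherical_paths n.
  by case: (lev _ n) ne => // p s _; exists p; rewrite inE eqxx.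
pose F (p : seq G) := \sum_(v <- p) x v.
have [p pn pmin] : exists2 p, p \in lev tree_spherical_paths n &
    forall q, q \in lev tree_spherical_paths n -> F p <= F q.
  elim: (lev _ n) p0 p0n => // p s IH _ _.
  case: s IH => [|q s] IH; first by exists p; rewrite ?inE // => r; rewrite inE => /eqP ->.
  have [r rs rmin] := IH q (mem_head q s).
  have [pr|rp] := leP (F p) (F r).
    exists p; rewrite ?inE ?eqxx // => u; rewrite inE => /predU1P[->//|us].
    exact: le_trans pr (rmin _ us).
  exists r; first by rewrite inE rs orbT.
  by move=> u; rewrite inE => /predU1P[->|us]; [exact: ltW|exact: rmin].
exists p => //; apply: le_trans fB; exact: le_first_passage.
Qed.

End FirstPassage.

End TreePaths.

(** * Explosion and the upper limit *)

Section LimsupCriteria.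
Context {R : realType}.
Local Open Scope ereal_scope.

Lemma limn_esup_le_of_eventually (u : nat -> R) (l : R) :
  (exists N, forall n, (N <= n)%N -> (u n <= l)%R) -> limn_esup (fun n => (u n)%:E) <= l%:E.
Proof.
move=> [N uN]; rewrite /limn_esup limf_esupE.
apply: (@le_trans _ _ (ereal_sup [set (u n)%:E | n in [set n | (N <= n)%N]])).
  apply: ereal_inf_lbound; exists [set n | (N <= n)%N] => //.
  exact: nbhs_infty_ge.
by apply: ge_ereal_sup => _ [n /= Nn <-]; rewrite lee_fin uN.
Qed.

Lemma limn_esup_ge_of_frequently (u : nat -> R) (l : R) :
  (forall N, exists2 n, (N <= n)%N & (l <= u n)%R) -> l%:E <= limn_esup (fun n => (u n)%:E).
Proof.
move=> uN; rewrite /limn_esup limf_esupE.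
apply: le_ereal_inf_tmp => _ [V [N _ NV] <-].
have [n Nn ln] := uN N; apply: (@le_trans _ _ (u n)%:E); first by rewrite lee_fin.
by apply: ereal_sup_ubound; exists n => //; exact: NV.
Qed.

End LimsupCriteria.

Section InverseSeries.
Context {R : realType} {f : nat -> nat}.
Hypothesis f_gt0 : forall n, (1 <= n)%N -> (1 <= f n)%N.
Local Notation phi := (ftilde R f).
Local Notation H := (inv_sum (R := R) (f := f)).
Local Notation series := (\sum_(1 <= n <oo) ((phi n)^-1)%:E)%E.

Lemma phi_inv_ge0 n : (1 <= n)%N -> true -> (0 <= ((phi n)^-1)%:E)%E.
Proof. by move=> n1 _; rewrite lee_fin invr_ge0 ltW // ftilde_gt0. Qed.

Lemma inv_sum_unbounded : series = +oo%E -> forall B : R, exists N, forall n, (N <= n)%N -> B < H n.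
Proof.
move=> soo B; have [N BN] : exists N, B < H N.
  apply: contrapT => /forallNP HB.
  have : (series <= B%:E)%E.
    apply: lime_le; first exact: is_cvg_nneseries phi_inv_ge0.
    apply: nearW => -[|n]; rewrite /= sumEFin lee_fin.
      by have /negP := HB 0%N; rewrite -leNgt /inv_sum !big_geq.
    by have /negP := HB n; rewrite -leNgt.
  by rewrite soo leye_eq.
by exists N => n Nn; rewrite (lt_le_trans BN) // inv_sum_le.
Qed.

Lemma inv_sum_bounded : (series < +oo)%E -> exists B : R, forall n, H n <= B.
Proof.
move=> sfin; exists (fine series) => n.
have s0 : (0 <= series)%E by apply: nneseries_ge0; exact: phi_inv_ge0.
rewrite -lee_fin fineK ?ge0_fin_numE // /inv_sum -sumEFin.
apply: nneseries_lim_ge; exact: phi_inv_ge0.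
Qed.

(** A bound [B] on [ftilde] would give partial sums of at least [n / B]. This supplies the
    hypothesis of the upper bound when the sum is finite. *)
Lemma ftilde_unbounded : (series < +oo)%E -> forall B : R, exists n, (1 <= n)%N /\ B < phi n.
Proof.
move=> /inv_sum_bounded[C HC] B; apply: contrapT => /forallNP nB.
have phiB n : (0 < n)%N -> phi n <= B.
  by move=> n0; have := nB n; rewrite leNgt => nBn; apply/negP => h; apply: nBn.
have B0 : 0 < B := lt_le_trans (ftilde_gt0 f_gt0 1 isT) (phiB 1%N isT).
have HB n : n%:R / B <= H n.
  elim: n => [|n IH]; first by rewrite mul0r /inv_sum big_geq.
  rewrite inv_sumS -natr1 mulrDl mul1r lerD // lef_pV2 ?posrE ?phiB //.
  exact: ftilde_gt0.
have C0 : 0 <= C by rewrite (le_trans _ (HC 0%N)) // /inv_sum big_geq.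
have := HB (Num.truncn (C * B)).+1; apply/negP; rewrite -ltNge.
rewrite (le_lt_trans (HC _)) // ltr_pdivlMr // truncnS_gt //.
Qed.

End InverseSeries.

Section ExplosionEvent.
Context {d : measure_display} {T : measurableType d} {R : realType}.
Variables (P : probability T R) (f : nat -> nat) (G : rooted_tree) (X : G -> {RV P >-> R}).
Hypothesis f_gt0 : forall n, (1 <= n)%N -> (1 <= f n)%N.
Hypothesis G_sym : spherically_symmetric G f.
Hypothesis X_indep : independent_on [set v : G | v <> tree_root G] X.
Hypothesis X_exp : forall v : G, v <> tree_root G -> standard_exponential (X v).

Local Notation S := (tree_spherical_paths G f G_sym).
Local Notation M t := (first_passage (fun v => X v t)).
Local Notation H := (inv_sum (R := R) (f := f)).

Lemma lev_neq0 n : lev S n != [::].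
Proof.
apply/eqP => e; have := growth_prod_gt0 (R := R) f_gt0 n.
by rewrite -(size_lev S) e ltxx.
Qed.

Lemma measurable_explosion : measurable (explosion X).
Proof.
have -> : explosion X = \bigcup_B \bigcap_n \big[setU/set0]_(p <- lev S n)
    [set t | wsum P G X (fun=> 1) p t <= B%:R].
  have E n B t : M t n <= B <->
      (\big[setU/set0]_(p <- lev S n) [set t | wsum P G X (fun=> 1) p t <= B]) t.
    rewrite -bigcup_seq; split.
      move=> /(first_passage_le_iff _ _ G_sym _ _ _ (lev_neq0 n))[p pn pB].
      by exists p => //=; rewrite wsum1.
    move=> [p /= pn]; rewrite wsum1 => pB.
    by apply/(first_passage_le_iff _ _ G_sym _ _ _ (lev_neq0 n)); exists p.
  apply/seteqP; split => t.
    move=> [B MB]; exists (Num.truncn B).+1 => // n _; apply/E.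
    by rewrite (le_trans (MB n)) // ltW // truncnS_gt.
  by move=> [B _ MB]; exists B%:R => n; apply/E; exact: MB.
apply: bigcupT_measurable => B; apply: bigcapT_measurable => n.
by apply: (proj1 (measure_bigsetU_seq P _ _ _ _)) => p _; exact: measurable_wsum_le.
Qed.

Lemma ae_first_passage_ge (c : R) : 0 <= c -> c < expR (-1) ->
  {ae P, forall t, exists B : R, forall N, exists2 n, (N <= n)%N & c * H n - B <= M t n}.
Proof.
move=> c0 ce; have := ae_lower_bound P G _ f S X f_gt0 X_indep X_exp c c0 ce.
apply: filterS => t [B h]; exists B => N; have [n Nn hn] := h N.
by exists n => //; apply: (le_first_passage _ _ G_sym _ _ _ (lev_neq0 n)).
Qed.

Lemma ae_first_passage_le (c : R) : expR (-1) < c ->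
  (forall B : R, exists n, (1 <= n)%N /\ B < ftilde R f n) ->
  {ae P, forall t, exists B : R, exists N0, forall N, (N0 <= N)%N -> M t N <= c * H N + B}.
Proof.
move=> ce unb; have := ae_upper_bound P G _ f S X f_gt0 X_indep X_exp c ce unb.
apply: filterS => t [B [N0 h]]; exists B, N0 => N N0N; have [p pN pB] := h N N0N.
by apply: le_trans pB; exact: (first_passage_le _ _ G_sym _ _ _ pN).
Qed.

Lemma explosion_null : (\sum_(1 <= n <oo) ((ftilde R f n)^-1)%:E = +oo)%E ->
  P (explosion X) = 0%E.
Proof.
move=> soo; apply/(negligibleP _ measurable_explosion).
have e0 : 0 < expR (-1) :> R := expR_gt0 _.
have c0 : 0 < expR (-1) / 2 :> R by rewrite divr_gt0.
have ce : expR (-1) / 2 < expR (-1) :> R by lra.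
have := ae_first_passage_ge _ (ltW c0) ce; apply: negligibleS => t /= [B MB].
move=> [B' low]; have [N HN] := inv_sum_unbounded f_gt0 soo ((B + B') / (expR (-1) / 2)).
have [n Nn lown] := low N; have := HN n Nn.
apply/negP; rewrite -leNgt ler_pdivlMr // mulrC -lerBlDr.
exact: le_trans lown (MB n).
Qed.

Lemma explosion_sure : (\sum_(1 <= n <oo) ((ftilde R f n)^-1)%:E < +oo)%E ->
  P (explosion X) = 1%E.
Proof.
move=> sfin; have unb := ftilde_unbounded f_gt0 sfin.
have [C HC] := inv_sum_bounded f_gt0 sfin.
have mE := measurable_explosion.
suff /(negligibleP _ (measurableC mE)) : P.-negligible (~` explosion X).
  by move=> h; have := probability_setC P (measurableC mE); rewrite setCK h sube0.
have e0 : 0 < expR (-1) :> R := expR_gt0 _.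
have ce : expR (-1) < expR (-1) + 1 :> R by rewrite ltrDl.
have := ae_first_passage_le _ ce unb; apply: negligibleS => t /= nexp.
apply: contra_not nexp => -[B [N0 h]].
(* The last sum covers the finitely many levels before [N0], where the upper bound says nothing. *)
exists ((expR (-1) + 1) * C + `|B| + \sum_(0 <= i < N0) `|M t i|) => n.
have s0 : 0 <= \sum_(0 <= i < N0) `|M t i| by apply: sumr_ge0.
have cC : 0 <= (expR (-1) + 1) * C.
  rewrite mulr_ge0 ?addr_ge0 ?(ltW e0) //.
  by rewrite (le_trans _ (HC 0%N)) // /inv_sum big_geq.
have [N0n|nN0] := leqP N0 n.
  apply: le_trans (h n N0n) _; rewrite -addrA lerD //.
    by rewrite ler_wpM2l // addr_ge0 // ltW.
  by rewrite (le_trans (ler_norm _)) // lerDl.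
apply: le_trans (ler_norm _) _; rewrite -[leLHS]add0r lerD ?addr_ge0 //.
rewrite (big_rem n) /=; last by rewrite mem_index_iota nN0.
by rewrite lerDl sumr_ge0.
Qed.

Lemma ae_limsup : (\sum_(1 <= n <oo) ((ftilde R f n)^-1)%:E = +oo)%E ->
  (forall B : R, exists n, (1 <= n)%N /\ B < ftilde R f n) ->
  {ae P, forall t, limn_esup (fun N => (M t N / H N)%:E) = (expR (-1))%:E}.
Proof.
move=> soo unb; set e := expR (-1) : R; have e0 : 0 < e := expR_gt0 _.
(* Countably many constants keep the exceptional set null. The lower ones approach [e] by a factor
   so as to stay nonnegative, as [ae_first_passage_ge] requires. *)
pose cl (j : nat) : R := e * (1 - j.+1%:R^-1); pose cu (j : nat) : R := e + j.+1%:R^-1.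
have j0 (j : nat) : 0 < j.+1%:R^-1 :> R by rewrite invr_gt0.
have cl0 j : 0 <= cl j by rewrite mulr_ge0 ?(ltW e0) // subr_ge0 invf_le1 // ler1n.
have cle j : cl j < e by rewrite /cl mulrBr mulr1 gtrBl mulr_gt0.
have cue j : e < cu j by rewrite ltrDl.
have low := ae_foralln (fun j => ae_first_passage_ge _ (cl0 j) (cle j)).
have up := ae_foralln (fun j => ae_first_passage_le _ (cue j) unb).
apply: filterS2 low up => t low up.
have small (B r : R) : 0 < r -> exists N, forall n, (N <= n)%N -> 0 < H n /\ B / H n <= r.
  move=> r0; have [N HN] := inv_sum_unbounded f_gt0 soo (`|B| / r).
  exists N => n Nn; have Hn := HN n Nn.
  have Hn0 : 0 < H n by rewrite (le_lt_trans _ Hn) // divr_ge0 // ltW.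
  split => //; rewrite ler_pdivrMr // mulrC -ler_pdivrMr //.
  by rewrite (le_trans _ (ltW Hn)) // ler_pM2r ?invr_gt0 // ler_norm.
have arch (r : R) : 0 < r -> exists j : nat, j.+1%:R^-1 < r.
  move=> r0; exists (Num.truncn r^-1); rewrite invf_plt ?posrE // truncnS_gt.
  by [].
apply/eqP; rewrite eq_le; apply/andP; split.
  apply/lee_addgt0Pr => r r0; rewrite -EFinD.
  have r2 : 0 < r / 2 by rewrite divr_gt0.
  have [j jr] := arch _ r2; have [B [N0 upj]] := up j.
  have [N1 sm] := small B _ r2; apply: limn_esup_le_of_eventually.
  exists (maxn N0 N1) => n; rewrite geq_max => /andP[n0 n1].
  have [Hn0 Bn] := sm n n1.
  apply: (@le_trans _ _ ((cu j * H n + B) / H n)); first by rewrite ler_pM2r ?invr_gt0 // upj.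
  rewrite mulrDl mulfK ?gt_eqF // /cu.
  by move: Bn jr; move: (B / H n) (j.+1%:R^-1) => x y; lra.
apply/lee_addgt0Pr => r r0; rewrite -leeBlDr // -EFinB.
have r2 : 0 < r / 2 by rewrite divr_gt0.
have [j jr] := arch _ (divr_gt0 r2 e0); have [B lowj] := low j.
have [N1 sm] := small B _ r2; apply: limn_esup_ge_of_frequently => N.
have [n nN lown] := lowj (maxn N N1).
move: nN; rewrite geq_max => /andP[nN nN1]; exists n => //.
have [Hn0 Bn] := sm n nN1.
apply: (@le_trans _ _ ((cl j * H n - B) / H n)); last by rewrite ler_pM2r ?invr_gt0.
rewrite mulrBl mulfK ?gt_eqF // /cl.
have : e * j.+1%:R^-1 <= r / 2 by rewrite mulrC -ler_pdivlMr // ltW.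
by move: Bn; move: (B / H n) (j.+1%:R^-1) => x y; lra.
Qed.

End ExplosionEvent.

Theorem theorem4 (R : realType) (d : measure_display) (T : measurableType d)
    (P : probability T R) (f : nat -> nat) (G : rooted_tree)
    (X : G -> {RV P >-> R})
    (f_gt0 : forall n, (1 <= n)%N -> (1 <= f n)%N)
    (G_sym : spherically_symmetric G f)
    (X_indep : independent_on [set v : G | v <> tree_root G] X)
    (X_exp : forall v : G, v <> tree_root G -> standard_exponential (X v)) :
  [/\ (\sum_(1 <= n <oo) ((ftilde R f n)^-1)%:E = +oo)%E ->
        P (explosion X) = 0%E,
      (\sum_(1 <= n <oo) ((ftilde R f n)^-1)%:E < +oo)%E ->
        P (explosion X) = 1%E
    & (\sum_(1 <= n <oo) ((ftilde R f n)^-1)%:E = +oo)%E ->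
      (forall B : R, exists n, (1 <= n)%N /\ B < ftilde R f n) ->
      {ae P, forall t,
        limn_esup (fun N => (first_passage (fun v => X v t) N /
                             \sum_(1 <= n < N.+1) (ftilde R f n)^-1)%:E)
        = (expR (-1))%:E}].
Proof.
split.
- exact: explosion_null f_gt0 G_sym X_indep X_exp.
- exact: explosion_sure f_gt0 G_sym X_indep X_exp.
- exact: ae_limsup f_gt0 G_sym X_indep X_exp.
Qed.
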